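(* Let $(\mathbb{R}^n,g)$ be a pseudo-Euclidean space, $n\ge3$, with coordinates $x=(x_1,\dots,x_n)$ and $g_{ij}=\delta_{ij}\varepsilon_i$, $\varepsilon_i=\pm1$. Consider a warped product $M=(\mathbb{R}^n,\overline g)\times_fF^m$ with metric $\widetilde g=\overline g+f^2g_F$, where $\overline g=\frac1{\varphi^2}g$, $F$ is an Einstein semi-Riemannian manifold with constant Ricci curvature $\lambda_F$, $m\ge1$, and $f=f(\xi)$, $\varphi=\varphi(\xi)$, $h=h(\xi)$ are smooth functions of $\xi=\sum_{i=1}^n\alpha_ix_i$, where $\alpha_i\in\mathbb{R}$ are not all zero and either $\sum_{i=1}^n\varepsilon_i\alpha_i^2=\varepsilon_{i_0}\in\{1,-1\}$ or $\sum_{i=1}^n\varepsilon_i\alpha_i^2=0$. Let $r\in\mathbb{N}$, $r\ge1$, and $\rho\in\mathbb{R}$. Then $(M,\widetilde g,h)$ is a quasi-Einstein semi-Riemannian manifold, i.e. $\mathrm{Ric}_{\widetilde g}-\frac rh\mathrm{Hess}_{\widetilde g}h=\rho\widetilde g$, if and only if $f,\varphi,h$ satisfy: (i) whenever $\sum_{i=1}^n\varepsilon_i\alpha_i^2=\varepsilon_{i_0}$, $$\begin{cases}(n-2)fh\varphi''-rf\varphi h''-mh\varphi f''-2mh\varphi'f'-2rf\varphi'h'=0\\ \displaystyle\sum_{k=1}^n\varepsilon_k\alpha_k^2\,[fh\varphi\varphi''-(n-1)fh(\varphi')^2+mh\varphi\varphi'f'+rf\varphi\varphi'h']=\rho fh\\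 \displaystyle\sum_{k=1}^n\varepsilon_k\alpha_k^2\,[-fh\varphi^2f''+(n-2)fh\varphi\varphi'f'-(m-1)h\varphi^2(f')^2-rf\varphi^2f'h']=h[\rho f^2-\lambda_F];\end{cases}$$ (ii) whenever $\sum_{i=1}^n\varepsilon_i\alpha_i^2=0$, $$\begin{cases}(n-2)fh\varphi''-rf\varphi h''-mh\varphi f''-2mh\varphi'f'-2rf\varphi'h'=0\\ \rho=\lambda_F=0.\end{cases}$$
   Context: Primes denote derivatives with respect to $\xi$. The warped product $(\mathbb{R}^n,\overline g)\times_fF^m$ is $\mathbb{R}^n\times F$ with the metric $\overline g+f^2g_F$. $F$ has dimension $m$ and metric $g_F$, and ''Einstein with constant Ricci curvature $\lambda_F$'' means $\mathrm{Ric}_{g_F}=\lambda_Fg_F$ with $\lambda_F\in\mathbb{R}$ constant. The functions $f,\varphi,h$ are functions on $\mathbb{R}^n$ depending only on $\xi$, with $f>0$ and $\varphi,h$ nowhere zero; $h$ is regarded as a function on $M$ via the projection $M\to\mathbb{R}^n$. *)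

(* Defs.v *)
From HB Require Import structures.
From mathcomp Require Import all_boot all_order all_algebra.
From mathcomp Require Import all_classical all_reals all_analysis.

Set Implicit Arguments.
Unset Strict Implicit.
Unset Printing Implicit Defensive.

Import Order.TTheory GRing.Theory Num.Theory.
Import numFieldNormedType.Exports.

Local Open Scope ring_scope.
Local Open Scope classical_set_scope.

Definition smooth1 (R : realType) (f : R -> R) : Prop :=
  forall (k : nat) (t : R), derivable (f^`(k)) t 1.

Section Coordinates.
Variables (R : realType) (m : nat).
Implicit Types (A : set 'rV[R]_m) (u : 'rV[R]_m -> R) (x : 'rV[R]_m).

Definition pderiv (i : 'I_m) u : 'rV[R]_m -> R := 'D_(delta_mx 0 i) u.

Fixpoint class_C (k : nat) A u : Prop :=
  (forall x, A x -> {for x, continuous u}) /\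
  match k with
  | 0 => True
  | k'.+1 => forall i : 'I_m,
      (forall x, A x -> derivable u x (delta_mx 0 i)) /\
      class_C k' A (pderiv i u)
  end.

Definition smooth_on A u : Prop := forall k, class_C k A u.

(* [G x] is the matrix of the coefficients g_ij(x) of a metric in coordinates. *)
Implicit Types G : 'rV[R]_m -> 'M[R]_m.

(* Gamma^k_ij of the Levi-Civita connection *)
Definition christoffel G (k i j : 'I_m) x : R :=
  2^-1 * \sum_l invmx (G x) k l *
    (pderiv i (fun y => G y j l) x + pderiv j (fun y => G y i l) x
       - pderiv l (fun y => G y i j) x).

(* The d_l-component of R(d_i, d_j) d_k, with the convention
   R(X, Y) Z = D_X D_Y Z - D_Y D_X Z - D_[X, Y] Z. *)
Definition riemann G (l k i j : 'I_m) x : R :=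
  pderiv i (christoffel G l j k) x - pderiv j (christoffel G l i k) x
  + \sum_s (christoffel G l i s x * christoffel G s j k x
              - christoffel G l j s x * christoffel G s i k x).

(* Ric(Y, Z) is the trace of X |-> R(X, Y) Z. *)
Definition ricci G (j k : 'I_m) x : R := \sum_i riemann G i k i j x.

Definition hessian G u (i j : 'I_m) x : R :=
  pderiv i (pderiv j u) x - \sum_k christoffel G k i j x * pderiv k u x.

End Coordinates.

(* [chart_map] is meaningful on [chart_dom] only, and [chart_inv] on the image
   [chart_cod]. *)
Record chart (R : realType) (T : topologicalType) (m : nat) := Chart {
  chart_dom : set T ;
  chart_map : T -> 'rV[R]_m ;
  chart_inv : 'rV[R]_m -> T }.

Section Charts.
Variables (R : realType) (T : topologicalType) (m : nat).
Implicit Types c d : chart R T m.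

Definition chart_cod c : set 'rV[R]_m := chart_map c @` chart_dom c.

Definition is_chart c : Prop :=
  [/\ open (chart_dom c),
      open (chart_cod c),
      {in chart_dom c, cancel (chart_map c) (chart_inv c)},
      forall p, chart_dom c p -> {for p, continuous (chart_map c)} &
      forall x, chart_cod c x -> {for x, continuous (chart_inv c)}].

Definition overlap c d : set 'rV[R]_m :=
  chart_map c @` (chart_dom c `&` chart_dom d).

Definition transition c d : 'rV[R]_m -> 'rV[R]_m :=
  chart_map d \o chart_inv c.

(* Row i holds the partial derivatives of the transition map along the i-th
   coordinate. *)
Definition transition_mx c d (x : 'rV[R]_m) : 'M[R]_m :=
  \matrix_(i, a) pderiv i (fun y => transition c d y 0 a) x.

End Charts.

(* A space with an atlas and, in each chart, the coefficients of a metric; the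
   axioms are in [semi_riemannian]. *)
Record pre_semi_riemannian (R : realType) (m : nat) := PreSemiRiemannian {
  carrier :> topologicalType ;
  chart_index : Type ;
  atlas : chart_index -> chart R carrier m ;
  metric : chart_index -> 'rV[R]_m -> 'M[R]_m }.
Arguments atlas {R m} M c : rename.
Arguments metric {R m} M c x : rename.

Section SemiRiemannian.
Variables (R : realType) (m : nat).
Implicit Type M : pre_semi_riemannian R m.

Definition smooth_manifold M : Prop :=
  [/\ hausdorff_space M, second_countable (T := M), [set: M] !=set0,
      forall p : M, exists c, chart_dom (atlas M c) p &
      forall c, is_chart (atlas M c)] /\
  forall c d (a : 'I_m),
    smooth_on (overlap (atlas M c) (atlas M d))
              (fun x => transition (atlas M c) (atlas M d) x 0 a).

(* The last condition is nondegeneracy together with constancy of the index: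
   at every point there is an orthonormal frame (the rows of [P]), and the
   signs [s] of its vectors can be chosen independently of the point. *)
Definition semi_riemannian_metric M : Prop :=
  [/\ forall c (i j : 'I_m),
        smooth_on (chart_cod (atlas M c)) (fun x => metric M c x i j),
      forall c x, chart_cod (atlas M c) x -> (metric M c x)^T = metric M c x,
      forall c d x, overlap (atlas M c) (atlas M d) x ->
        let J := transition_mx (atlas M c) (atlas M d) x in
        metric M c x =
          J *m metric M d (transition (atlas M c) (atlas M d) x) *m J^T &
      exists2 s : 'rV[R]_m, (forall i, s 0 i = 1 \/ s 0 i = -1) &
        forall c x, chart_cod (atlas M c) x ->
          exists2 P : 'M[R]_m, P \in unitmx & P *m metric M c x *m P^T = diag_mx s].

Definition semi_riemannian M : Prop :=
  smooth_manifold M /\ semi_riemannian_metric M.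

Definition einstein M (lambda : R) : Prop :=
  forall c x, chart_cod (atlas M c) x ->
    forall i j, ricci (metric M c) i j x = lambda * metric M c x i j.

Definition quasi_einstein M (h : M -> R) (r : nat) (rho : R) : Prop :=
  semi_riemannian M /\
  forall c x, chart_cod (atlas M c) x ->
    let hc := h \o chart_inv (atlas M c) in
    forall i j, ricci (metric M c) i j x
                  - r%:R / hc x * hessian (metric M c) hc i j x
                = rho * metric M c x i j.

Definition conformal_change M (phi : M -> R) : pre_semi_riemannian R m :=
  @PreSemiRiemannian R m M (chart_index M) (atlas M)
    (fun c x => (phi (chart_inv (atlas M c) x)) ^- 2 *: metric M c x).

Definition euclid_chart : chart R 'rV[R]_m m := Chart setT id id.

Definition pseudo_euclidean (eps : 'I_m -> R) : pre_semi_riemannian R m :=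
  @PreSemiRiemannian R m 'rV[R]_m unit (fun=> euclid_chart)
    (fun _ _ => diag_mx (\row_i eps i)).

End SemiRiemannian.

Section WarpedProduct.
Variables (R : realType) (n m : nat).

Definition prod_chart (S T : topologicalType) (c : chart R S n)
    (d : chart R T m) : chart R (S * T)%type (n + m) :=
  Chart (chart_dom c `*` chart_dom d)
    (fun p => row_mx (chart_map c p.1) (chart_map d p.2))
    (fun x => (chart_inv c (lsubmx x), chart_inv d (rsubmx x))).

Definition warped_product (B : pre_semi_riemannian R n)
    (F : pre_semi_riemannian R m) (f : B -> R) : pre_semi_riemannian R (n + m) :=
  @PreSemiRiemannian R (n + m) (B * F)%type (chart_index B * chart_index F)%type
    (fun c => prod_chart (atlas B c.1) (atlas F c.2))
    (fun c x =>
       block_mx (metric B c.1 (lsubmx x)) 0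
         0 (f (chart_inv (atlas B c.1) (lsubmx x)) ^+ 2
              *: metric F c.2 (rsubmx x))).

End WarpedProduct.

(* Main.v *)
(* In the coordinates of R^n times a chart of F, every nonzero Christoffel symbol of
   g~ is a Christoffel symbol of F or carries exactly one of the factors
   phi'/phi, f'/f and phi^2 f f', which are functions of xi.  Hence the base block of
   Ric - (r/h) Hess h - rho g~ has the form
     alpha_j alpha_k s + eps_j delta_jk e,
   the mixed blocks vanish identically and the fibre block is a multiple of
   g_F, so that the equation amounts to one scalar equation for the fibre and,
   as n >= 2 and alpha <> 0, to s = e = 0 for the base. *)
Require Import Defs.
From HB Require Import structures.
From mathcomp Require Import all_boot all_order all_algebra.
From mathcomp Require Import all_classical all_reals all_analysis.
From mathcomp Require Import ring lra.
Import Order.TTheory GRing.Theory Num.Theory.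
Import numFieldNormedType.Exports.
Local Open Scope ring_scope.
Local Open Scope classical_set_scope.

Set Implicit Arguments.
Unset Strict Implicit.
Unset Printing Implicit Defensive.

(** * Functions of class C^k *)

(** [quasi_einstein] includes the claim that M is a semi-Riemannian manifold, so atlas, smoothness,
    transformation law and constant signature of the warped metric must be established as well. The
    metric arises from the flat one by a conformal change and then a warping; each operation
    rescales orthonormal frames and leaves their signs alone.

    Curvature is defined by partial derivatives of total functions, while the formulas for the
    Christoffel symbols hold only over the image of a chart of F, where the matrix of g_F is known
    to be symmetric and invertible. That image is open, which is what allows the formulas to be
    differentiated. Functions of xi alone, or of the fibre coordinates alone, are composites with
    linear maps and have the difference quotients of the inner function.

    The equations at the points of M become equations for every real t because xi is onto and F has
    a point. In the null case the last two equations degenerate to rho f h = 0 and h (rho f^2 -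
    lambda_F) = 0; as f and h never vanish, this says rho = 0 and then lambda_F = 0. *)

Section LinearSubstitution.
Variables (R : realType) (U V : normedModType R) (L : {linear U -> V}).
Implicit Types (u : V -> R) (x v : U).

(** The two difference quotients coincide term by term, so the identity holds even where the limit
    does not exist. *)
Lemma derive_comp_linear u v x : 'D_v (u \o L) x = 'D_(L v) u (L x).
Proof. by rewrite /derive; under eq_fun do rewrite /= linearP. Qed.

Lemma derivable_comp_linear u v x :
  derivable (u \o L) x v <-> derivable u (L x) (L v).
Proof. by rewrite /derivable; under eq_fun do rewrite /= linearP. Qed.

End LinearSubstitution.

Section ClassC.
Variables (R : realType) (m : nat).
Implicit Types (A : set 'rV[R]_m) (u v : 'rV[R]_m -> R).

Lemma class_CS k A u : class_C k.+1 A u -> class_C k A u.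
Proof.
elim: k u => [u [cu _]|k IH u [cu du]]; split=> // i.
by have [dui Cui] := du i; split=> //; apply: IH.
Qed.

Lemma class_C_continuous k A u x : class_C k A u -> A x ->
  {for x, continuous u}.
Proof. by case: k => [|k] [cu _]; exact: cu. Qed.

(** Openness of [A] makes agreement on [A] an agreement near each of its points, which derivatives
    respect. The product and quotient rules below give the partial derivatives on [A] only. *)
Lemma eq_class_C k A u v : open A -> (forall x, A x -> u x = v x) ->
  class_C k A u -> class_C k A v.
Proof.
move=> oA.
have near_eq (w w' : 'rV[R]_m -> R) : (forall x, A x -> w x = w' x) ->
    forall x, A x -> \near x, w x = w' x.
  by move=> ww' x Ax; apply: filterS (open_nbhs_nbhs (conj oA Ax)).
have cont (u' w : 'rV[R]_m -> R) :
    (forall x, A x -> u' x = w x) -> class_C 0 A u' -> class_C 0 A w.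
  move=> uw [cu _]; split=> // x Ax; have := cu x Ax.
  rewrite /prop_for /continuous_at -(uw x Ax); apply: cvg_trans.
  have e := near_eq _ _ uw x Ax.
  exact: (@near_eq_cvg _ _ (nbhs x) _ u' w e).
elim: k u v => [|k IH] u v uv Cu; first exact: cont uv Cu.
split=> [x|i].
  by apply: (cont u v uv _).1; split=> // y Ay; exact: class_C_continuous Cu Ay.
have [dui Cui] := Cu.2 i; split.
  by move=> x Ax; apply: near_eq_derivable (dui x Ax); exact: near_eq.
by apply: IH Cui => x Ax; apply: near_eq_derive; exact: near_eq.
Qed.

Lemma class_C_cst k A a : class_C k A (fun=> a).
Proof.
elim: k a => [|k IH] a; (split; first by move=> x _; exact: cst_continuous).
  by [].
move=> i; split=> [x _|]; first exact: derivable_cst.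
have -> : pderiv i (fun=> a) = fun=> 0 by apply/funext => x; exact: derive_cst.
exact: IH.
Qed.

Lemma class_CD k A u v : open A ->
  class_C k A u -> class_C k A v -> class_C k A (fun x => u x + v x).
Proof.
move=> oA; elim: k u v => [|k IH] u v Cu Cv;
  (split; first by move=> x Ax; exact: cvgD (class_C_continuous Cu Ax)
                                            (class_C_continuous Cv Ax)).
  by [].
move=> i; have [dui Cui] := Cu.2 i; have [dvi Cvi] := Cv.2 i; split.
  by move=> x Ax; apply: derivableD; [exact: dui|exact: dvi].
apply: eq_class_C (IH _ _ Cui Cvi) => // x Ax.
by rewrite /pderiv deriveD; [|exact: dui|exact: dvi].
Qed.

Lemma class_CM k A u v : open A ->
  class_C k A u -> class_C k A v -> class_C k A (fun x => u x * v x).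
Proof.
move=> oA; elim: k u v => [|k IH] u v Cu Cv;
  (split; first by move=> x Ax; exact: cvgM (class_C_continuous Cu Ax)
                                            (class_C_continuous Cv Ax)).
  by [].
move=> i; have [dui Cui] := Cu.2 i; have [dvi Cvi] := Cv.2 i; split.
  by move=> x Ax; apply: derivableM; [exact: dui|exact: dvi].
(* In each term of the product rule the undifferentiated factor is needed one order lower, hence
   [class_CS]. *)
have := class_CD oA (IH _ _ (class_CS Cu) Cvi) (IH _ _ (class_CS Cv) Cui).
apply: eq_class_C => // x Ax.
by rewrite /pderiv deriveM; [|exact: dui|exact: dvi].
Qed.

(** The derivative of 1/u is -(1/u)(1/u) Du, in which 1/u has the order of differentiability granted
    by induction. *)
Lemma class_CV k A u : open A -> (forall x, A x -> u x != 0) ->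
  class_C k A u -> class_C k A (fun x => (u x)^-1).
Proof.
move=> oA u0; elim: k => [|k IH] Cu;
  (split; first by move=> x Ax; exact: cvgV (u0 x Ax) (class_C_continuous Cu Ax)).
  by [].
move=> i; have [dui Cui] := Cu.2 i; split.
  by move=> x Ax; apply: derivableV; [exact: u0|exact: dui].
have CV := IH (class_CS Cu).
have := class_CM oA (class_C_cst k A (-1)) (class_CM oA (class_CM oA CV CV) Cui).
apply: eq_class_C => // x Ax.
rewrite /pderiv deriveV; [|exact: u0|exact: dui].
by rewrite scaleNr mulN1r expr2 invfM.
Qed.

Lemma is_derive_coord (j : 'I_m) (x v : 'rV[R]_m) :
  is_derive x v (fun y : 'rV[R]_m => y 0 j) (v 0 j).
Proof.
apply: DeriveDef; first exact/diff_derivable/differentiable_coord.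
apply: cvg_lim => //; apply: cvg_near_cst; near=> t.
have t0 : t != 0 by near: t; exact: nbhs_dnbhs_neq.
by rewrite /= !mxE addrK -[LHS]/(t^-1 * (t * _)) mulKf.
Unshelve. all: by end_near. Qed.

Lemma class_C_coord k A (j : 'I_m) : class_C k A (fun x => x 0 j).
Proof.
case: k => [|k]; (split; first by move=> x _; exact: coord_continuous).
  by [].
move=> i; split=> [x _|]; first by case: (is_derive_coord j x (delta_mx 0 i)).
have -> : pderiv i (fun y : 'rV[R]_m => y 0 j) = cst ((delta_mx 0 i : 'rV[R]_m) 0 j).
  by apply/funext => x; case: (is_derive_coord j x (delta_mx 0 i)).
exact: class_C_cst.
Qed.

Definition linform (a : 'I_m -> R) (x : 'rV[R]_m) : R := \sum_(i < m) a i * x 0 i.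

Lemma linform_is_linear a : linear (linform a : 'rV[R]_m -> R^o).
Proof.
move=> c x y; rewrite /linform scaler_sumr -big_split; apply: eq_bigr => i _.
by rewrite !mxE /= mulrDr mulrCA.
Qed.
HB.instance Definition _ a :=
  GRing.isLinear.Build R 'rV[R]_m R^o _ (linform a) (linform_is_linear a).

Lemma linform_delta a i : linform a (delta_mx 0 i) = a i.
Proof.
rewrite /linform (bigD1 i) //= mxE !eqxx mulr1 big1 ?addr0 // => j ji.
by rewrite mxE (negPf ji) mulr0.
Qed.

Lemma linform_continuous a : continuous (linform a).
Proof.
apply: continuous_big => [|i _ x]; first exact: add_continuous.
by apply: continuousM; [exact: cst_continuous|exact: coord_continuous].
Qed.

End ClassC.

(** When basis vectors go to basis vectors or to 0, each partial derivative of [u \o L] is 0 or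
    again a partial derivative of [u] composed with [L], so the induction closes. The projections
    [lsubmx] and [rsubmx] are of this kind. *)
Lemma class_C_comp_linear (R : realType) (p q : nat)
    (L : {linear 'rV[R]_p -> 'rV[R]_q}) k (A : set 'rV[R]_q) u :
  continuous L ->
  (forall i, L (delta_mx 0 i) = 0 \/ exists j, L (delta_mx 0 i) = delta_mx 0 j) ->
  class_C k A u -> class_C k (L @^-1` A) (u \o L).
Proof.
move=> cL HL; elim: k u => [|k IH] u [cu du];
  (split; first by move=> x Ax; apply: continuous_comp; [exact: cL|exact: cu]).
  by [].
move=> i; have [Li|[j Li]] := HL i.
  split=> [x _|].
    by apply/derivable_comp_linear; rewrite Li; exact: derivable0.
  have -> : pderiv i (u \o L) = fun=> 0.
    by apply/funext=> x; rewrite /pderiv derive_comp_linear Li derive0.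
  exact: class_C_cst.
have [duj Cuj] := du j; split=> [x Ax|].
  by apply/derivable_comp_linear; rewrite Li; exact: duj.
have -> : pderiv i (u \o L) = pderiv j u \o L; last exact: IH.
by apply/funext=> x; rewrite /pderiv derive_comp_linear Li.
Qed.

Lemma is_derive_line (R : realType) (g : R -> R) (t c : R) :
  derivable g t 1 -> is_derive t c g (c * g^`()%classic t).
Proof.
move=> /derivable1_diffP dg; apply: DeriveDef; first exact: diff_derivable.
by rewrite deriveE // deriv1E // derivable1_diffP.
Qed.

Lemma smooth1_derive1 (R : realType) (g : R -> R) : smooth1 g -> smooth1 g^`()%classic.
Proof. by move=> sg k t; rewrite -derive1Sn; exact: sg. Qed.

Section Ridge.
Variables (R : realType) (m : nat) (a : 'I_m -> R).

Lemma is_derive_ridge (g : R -> R) (x v : 'rV[R]_m) :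
  derivable g (linform a x) 1 ->
  is_derive x v (g \o linform a) (linform a v * g^`()%classic (linform a x)).
Proof.
move=> dg; have [d1 d2] := is_derive_line (linform a v) dg.
apply: DeriveDef; first exact/(@derivable_comp_linear R _ R^o).
by rewrite (@derive_comp_linear R _ R^o).
Qed.

(** A partial derivative of [g \o linform a] is a constant times the same construction applied to
    the derivative of [g]. *)
Lemma class_C_ridge k (g : R -> R) : smooth1 g -> class_C k setT (g \o linform a).
Proof.
elim: k g => [|k IH] g sg.
all: have cg : continuous (g \o linform a).
1,3: move=> x; apply: continuous_comp; first exact: linform_continuous.
1,2: by apply/differentiable_continuous/derivable1_diffP; exact: (sg 0).
  by split=> // x _; exact: cg.
split=> [x _|i]; first exact: cg.
split=> [x _|].
  by case: (is_derive_ridge (delta_mx 0 i) (sg 0 (linform a x))).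
apply: (@eq_class_C _ _ _ _ (fun x => a i * (g^`()%classic \o linform a) x)) => //.
- exact: openT.
- move=> x _; have [_] := is_derive_ridge (delta_mx 0 i) (sg 0 (linform a x)).
  by rewrite linform_delta => <-.
- apply: class_CM; [exact: openT|exact: class_C_cst|].
  by apply: IH; exact: smooth1_derive1.
Qed.

End Ridge.

(** * Product topology and product charts *)

Section ProductTopology.
Variables S T : topologicalType.

Lemma openX (A : set S) (B : set T) : open A -> open B -> open (A `*` B).
Proof.
move=> oA oB; rewrite openE => -[x y] [/= Ax By].
by exists (A, B) => //; split; exact: open_nbhs_nbhs.
Qed.

(** Testing the cluster condition on cylinders over one factor, with the whole space as the other
    side, gives the cluster condition in that factor. *)
Lemma hausdorff_prod : hausdorff_space S -> hausdorff_space T ->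
  hausdorff_space (S * T)%type.
Proof.
move=> hS hT [x1 x2] [y1 y2] clxy.
have rect (z : S * T) (A : set S) (B : set T) : nbhs z.1 A -> nbhs z.2 B ->
  nbhs z (A `*` B) by move=> zA zB; exists (A, B).
congr pair.
- apply: hS => A B Ax By.
  have [[z1 z2] [[/= Az _] [/= Bz _]]] :=
    clxy (A `*` setT) (B `*` setT)
      (rect (x1, x2) _ _ Ax filterT) (rect (y1, y2) _ _ By filterT).
  by exists z1.
- apply: hT => A B Ax By.
  have [[z1 z2] [[/= _ Az] [/= _ Bz]]] :=
    clxy (setT `*` A) (setT `*` B)
      (rect (x1, x2) _ _ filterT Ax) (rect (y1, y2) _ _ filterT By).
  by exists z2.
Qed.

Lemma second_countable_prod :
  second_countable (T := S) -> second_countable (T := T) ->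
  second_countable (T := (S * T)%type).
Proof.
move=> [B cB [oB bB]] [C cC [oC bC]].
exists [set UV.1 `*` UV.2 | UV in B `*` C].
  exact: card_le_trans (card_image_le _ _) (countableX cB cC).
split=> [_ [[U V] [/= BU CV] <-]|[x y] W [[P Q] /= [Px Qy] PQW]].
  by apply: openX; [exact: oB|exact: oC].
have [U [BU Ux] UP] := bB x P Px; have [V [CV Vy] VQ] := bC y Q Qy.
exists (U `*` V); first by split=> //; exists (U, V).
by move=> [z t] [/= Uz Vt]; apply: PQW; split; [exact: UP|exact: VQ].
Qed.

End ProductTopology.

Lemma continuous_pair (X Y Z : topologicalType) (f : X -> Y) (g : X -> Z) x :
  {for x, continuous f} -> {for x, continuous g} ->
  {for x, continuous (fun y => (f y, g y))}.
Proof.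
by move=> cf cg;
   exact: (@cvg_pair _ _ _ (nbhs x) (nbhs (f x)) (nbhs (g x)) _ _ _ f g cf cg).
Qed.

Lemma second_countable_rV (R : realType) (n : nat) :
  second_countable (T := 'rV[R]_n).
Proof.
pose B (qk : 'rV[rat]_n * nat) : set 'rV[R]_n :=
  ball (\row_j ratr (qk.1 0 j) : 'rV[R]_n) (qk.2.+1%:R^-1 : R).
exists (range B); first exact: card_le_trans (card_image_le _ _) (countableP _).
split=> [_ [qk _ <-]|x V]; first exact: ball_open.
move=> /nbhs_ballP[e /= e0 eV].
(* A ball of radius d = 1/(k+1) with rational centre within d of x contains x and lies in the ball
   of radius 2d around x; this is why e is halved. *)
have [k ke] : exists k : nat, (k.+1%:R^-1 : R) < e / 2.
  have [|k] := @ltr_add_invr R 0 (e / 2); first by rewrite divr_gt0.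
  by rewrite add0r; exists k.
pose d : R := k.+1%:R^-1; have d0 : 0 < d by rewrite invr_gt0.
have /choice[q xq] (j : 'I_n) : exists q : rat, ball (x 0 j) d (ratr q).
  have [|y [/= xy [q _ qy]]] := @dense_rat R (ball (x 0 j) d) _ (ball_open _ _).
    by exists (x 0 j); exact: ballxx.
  by exists q; rewrite qy.
pose Q : 'rV[rat]_n := \row_j q j.
have xQ : B (Q, k) x.
  by split=> // i j; rewrite !mxE; apply: ball_sym; rewrite (ord1 i); exact: xq.
exists (B (Q, k)); first by split=> //; exists (Q, k).
move=> z Qz; apply: eV.
have : ball x (d + d) z by apply: ball_triangle Qz; exact: ball_sym.
by apply: le_ball; rewrite -/d in ke; lra.
Qed.

Section ProductChart.
Variables (R : realType) (n m : nat) (S T : topologicalType).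
Implicit Types (c : chart R S n) (d : chart R T m).

Lemma continuous_row_mx (x : 'rV[R]_n * 'rV[R]_m) :
  {for x, continuous (fun p : 'rV[R]_n * 'rV[R]_m => row_mx p.1 p.2)}.
Proof.
move=> A /nbhs_ballP[e /= e0 eA].
exists (ball x.1 e, ball x.2 e); first by split; exact: nbhsx_ballx.
move=> [y z] /= [[_ xy] [_ xz]]; apply: eA; split => // i j.
by rewrite !mxE; case: split_ordP => k _.
Qed.

Lemma prod_chart_cod c d : chart_cod (prod_chart c d) =
  lsubmx @^-1` chart_cod c `&` rsubmx @^-1` chart_cod d.
Proof.
apply/seteqP; split=> [_ [[p q] [/= cp dq] <-]|x [/= [p cp px] [q dq qx]]].
  by split; rewrite /= ?row_mxKl ?row_mxKr; [exists p|exists q].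
by exists (p, q) => //=; rewrite px qx hsubmxK.
Qed.

Lemma prod_chart_overlap c c' d d' : overlap (prod_chart c d) (prod_chart c' d') =
  lsubmx @^-1` overlap c c' `&` rsubmx @^-1` overlap d d'.
Proof.
apply/seteqP; split.
  move=> _ [[p q] [[/= cp dq] [/= c'p d'q]] <-].
  by split; rewrite /= ?row_mxKl ?row_mxKr; [exists p|exists q].
move=> x [/= [p [cp c'p] px] [q [dq d'q] qx]].
by exists (p, q) => //=; rewrite px qx hsubmxK.
Qed.

Lemma is_chart_prod c d : is_chart c -> is_chart d -> is_chart (prod_chart c d).
Proof.
move=> [oc occ cK cc cc'] [od ocd dK cd cd']; split.
- exact: openX.
- rewrite prod_chart_cod; apply: openI; apply: open_comp => // x _.
    exact: continuous_lsubmx.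
  exact: continuous_rsubmx.
- move=> [p q]; rewrite inE => -[/= cp dq].
  by rewrite row_mxKl row_mxKr cK ?dK ?inE.
- move=> [p q] [/= cp dq].
  apply: (@continuous_comp _ _ _ (fun p => (chart_map c p.1, chart_map d p.2))
            (fun p => row_mx p.1 p.2)); last exact: continuous_row_mx.
  apply: continuous_pair; apply: continuous_comp;
    [exact: cvg_fst|exact: cc|exact: cvg_snd|exact: cd].
- move=> x; rewrite prod_chart_cod => -[/= cx dx].
  apply: continuous_pair; apply: continuous_comp;
    [exact: continuous_lsubmx|exact: cc'|exact: continuous_rsubmx|exact: cd'].
Qed.

End ProductChart.

(** * Warped products and conformal changes of metric *)

Lemma sub_class_C (R : realType) (m k : nat) (A B : set 'rV[R]_m) u : B `<=` A ->
  class_C k A u -> class_C k B u.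
Proof.
move=> BA; elim: k u => [|k IH] u [cu du].
  by split=> // x /BA; exact: cu.
split=> [x /BA|i]; first exact: cu.
by have [dui Cui] := du i; split=> [x /BA|]; [exact: dui|exact: IH].
Qed.

(** If [P] is an orthonormal frame for [G], then [a *: P] is one for [b *: G] as soon as a^2 b = 1;
    both changes of metric obtain their frames in this way. *)
Lemma congruence_scale (R : comNzRingType) (k : nat) (a b : R) (P G : 'M[R]_k) :
  (a *: P) *m (b *: G) *m (a *: P)^T = (a ^+ 2 * b) *: (P *m G *m P^T).
Proof.
rewrite [(a *: P)^T]linearZ /= -scalemxAr -!scalemxAl -scalemxAr -scalemxAl.
by rewrite !scalerA expr2.
Qed.

Section Blocks.
Variables (R : realType) (n m : nat).

Lemma lsubmx_delta (i : 'I_(n + m)) :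
  lsubmx (delta_mx 0 i : 'rV[R]_(n + m)) = 0 \/
  exists j, lsubmx (delta_mx 0 i : 'rV[R]_(n + m)) = delta_mx 0 j.
Proof.
case: (split_ordP i) => j ->.
  by right; exists j; rewrite delta_mx_lshift row_mxKl.
by left; rewrite delta_mx_rshift row_mxKl.
Qed.

Lemma rsubmx_delta (i : 'I_(n + m)) :
  rsubmx (delta_mx 0 i : 'rV[R]_(n + m)) = 0 \/
  exists j, rsubmx (delta_mx 0 i : 'rV[R]_(n + m)) = delta_mx 0 j.
Proof.
case: (split_ordP i) => j ->.
  by left; rewrite delta_mx_lshift row_mxKr.
by right; exists j; rewrite delta_mx_rshift row_mxKr.
Qed.

Lemma smooth_on_lsubmx (A : set 'rV[R]_n) (B : set 'rV[R]_(n + m)) u :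
  B `<=` lsubmx @^-1` A -> smooth_on A u -> smooth_on B (u \o lsubmx).
Proof.
move=> BA Cu k; apply: sub_class_C BA _.
by apply: (@class_C_comp_linear R (n + m) n lsubmx);
  [exact: continuous_lsubmx|exact: lsubmx_delta|exact: Cu].
Qed.

Lemma smooth_on_rsubmx (A : set 'rV[R]_m) (B : set 'rV[R]_(n + m)) u :
  B `<=` rsubmx @^-1` A -> smooth_on A u -> smooth_on B (u \o rsubmx).
Proof.
move=> BA Cu k; apply: sub_class_C BA _.
by apply: (@class_C_comp_linear R (n + m) m rsubmx);
  [exact: continuous_rsubmx|exact: rsubmx_delta|exact: Cu].
Qed.

Lemma pderiv_lsubmx_lshift (u : 'rV[R]_n -> R) i x :
  pderiv (lshift m i) (u \o lsubmx) x = pderiv i u (lsubmx x).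
Proof.
rewrite /pderiv (@derive_comp_linear R 'rV[R]_(n + m) 'rV[R]_n lsubmx).
by rewrite /= delta_mx_lshift row_mxKl.
Qed.

Lemma pderiv_lsubmx_rshift (u : 'rV[R]_n -> R) (a : 'I_m) x :
  pderiv (rshift n a) (u \o lsubmx) x = 0.
Proof.
rewrite /pderiv (@derive_comp_linear R 'rV[R]_(n + m) 'rV[R]_n lsubmx).
by rewrite /= delta_mx_rshift row_mxKl derive0.
Qed.

Lemma pderiv_rsubmx_lshift (u : 'rV[R]_m -> R) (i : 'I_n) x :
  pderiv (lshift m i) (u \o rsubmx) x = 0.
Proof.
rewrite /pderiv (@derive_comp_linear R 'rV[R]_(n + m) 'rV[R]_m rsubmx).
by rewrite /= delta_mx_lshift row_mxKr derive0.
Qed.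

Lemma pderiv_rsubmx_rshift (u : 'rV[R]_m -> R) a x :
  pderiv (rshift n a) (u \o rsubmx) x = pderiv a u (rsubmx x).
Proof.
rewrite /pderiv (@derive_comp_linear R 'rV[R]_(n + m) 'rV[R]_m rsubmx).
by rewrite /= delta_mx_rshift row_mxKr.
Qed.

End Blocks.

(** The conformal factor and the warping function live on the manifold; this identity gives them the
    same value in two overlapping charts, as the transformation law of the metric demands. *)
Lemma chart_inv_transition (R : realType) (T : topologicalType) (m : nat)
    (c d : chart R T m) x : is_chart c -> is_chart d -> overlap c d x ->
  chart_inv d (transition c d x) = chart_inv c x.
Proof.
move=> [_ _ cK _ _] [_ _ dK _ _] [p [cp dp] <-].
by rewrite /transition /= cK ?inE // dK ?inE.
Qed.

Section SemiRiemannianWarped.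
Variables (R : realType) (n m : nat).
Variables (B : pre_semi_riemannian R n) (F : pre_semi_riemannian R m) (f : B -> R).
Let M := warped_product F f.

Lemma smooth_manifold_warped :
  smooth_manifold B -> smooth_manifold F -> smooth_manifold M.
Proof.
move=> [[hB cB [b _] coB chB] trB] [[hF cF [p _] coF chF] trF].
split; first split.
- exact: hausdorff_prod.
- exact: second_countable_prod.
- by exists (b, p).
- move=> [x y]; have [c cx] := coB x; have [d dy] := coF y.
  by exists (c, d).
- by move=> [c d]; exact: is_chart_prod.
move=> [c d] [c' d'] a; rewrite prod_chart_overlap.
case: (split_ordP a) => j ->.
  have -> : (fun x => transition (atlas M (c, d)) (atlas M (c', d')) x 0 (lshift m j))
      = (fun x => transition (atlas B c) (atlas B c') x 0 j) \o lsubmx.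
    by apply/funext => x; rewrite /transition /= row_mxEl.
  by apply: smooth_on_lsubmx (trB c c' j) => x [].
have -> : (fun x => transition (atlas M (c, d)) (atlas M (c', d')) x 0 (rshift n j))
    = (fun x => transition (atlas F d) (atlas F d') x 0 j) \o rsubmx.
  by apply/funext => x; rewrite /transition /= row_mxEr.
by apply: smooth_on_rsubmx (trF d d' j) => x [].
Qed.

(** Every component of a transition map of the product depends on the coordinates of one factor
    only. *)
Lemma transition_mx_warped (c c' : chart_index B) (d d' : chart_index F) x :
  transition_mx (atlas M (c, d)) (atlas M (c', d')) x =
  block_mx (transition_mx (atlas B c) (atlas B c') (lsubmx x)) 0
    0 (transition_mx (atlas F d) (atlas F d') (rsubmx x)).
Proof.
apply/matrixP => i a; rewrite mxE.
have trl j : (fun y => transition (atlas M (c, d)) (atlas M (c', d')) y 0 (lshift m j))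
    = (fun y => transition (atlas B c) (atlas B c') y 0 j) \o lsubmx.
  by apply/funext => y; rewrite /transition /= row_mxEl.
have trr j : (fun y => transition (atlas M (c, d)) (atlas M (c', d')) y 0 (rshift n j))
    = (fun y => transition (atlas F d) (atlas F d') y 0 j) \o rsubmx.
  by apply/funext => y; rewrite /transition /= row_mxEr.
case: (split_ordP i) => k ->; case: (split_ordP a) => j ->; rewrite ?trl ?trr.
- by rewrite block_mxEul mxE pderiv_lsubmx_lshift.
- by rewrite block_mxEur mxE pderiv_rsubmx_lshift.
- by rewrite block_mxEdl mxE pderiv_lsubmx_rshift.
- by rewrite block_mxEdr mxE pderiv_rsubmx_rshift.
Qed.

Lemma semi_riemannian_warped :
  (forall b, f b != 0) ->
  (forall c, smooth_on (chart_cod (atlas B c)) (f \o chart_inv (atlas B c))) ->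
  semi_riemannian B -> semi_riemannian F -> semi_riemannian M.
Proof.
move=> f0 fC [mB [gB symB compB [sB sB1 frB]]] [mF [gF symF compF [sF sF1 frF]]].
have chB c : is_chart (atlas B c) by case: mB => -[].
have chF c : is_chart (atlas F c) by case: mF => -[].
split; first exact: smooth_manifold_warped.
split.
- move=> [c d] i j; rewrite prod_chart_cod.
  set A := _ `&` _.
  have Al : A `<=` lsubmx @^-1` chart_cod (atlas B c) by move=> x [].
  have Ar : A `<=` rsubmx @^-1` chart_cod (atlas F d) by move=> x [].
  have oA : open A.
    have [_ occ _ _ _] := chB c; have [_ ocd _ _ _] := chF d.
    by apply: openI; apply: open_comp => // x _;
      [exact: continuous_lsubmx|exact: continuous_rsubmx].
  case: (split_ordP i) => k ->; case: (split_ordP j) => l ->.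
  + have -> : (fun x => metric M (c, d) x (lshift m k) (lshift m l)) =
      (fun x => metric B c x k l) \o lsubmx.
      by apply/funext => x; rewrite /= block_mxEul.
    exact: smooth_on_lsubmx Al (gB c k l).
  + have -> : (fun x => metric M (c, d) x (lshift m k) (rshift n l)) = fun=> 0.
      by apply/funext => x; rewrite /= block_mxEur mxE.
    by move=> r; exact: class_C_cst.
  + have -> : (fun x => metric M (c, d) x (rshift n k) (lshift m l)) = fun=> 0.
      by apply/funext => x; rewrite /= block_mxEdl mxE.
    by move=> r; exact: class_C_cst.
  + have -> : (fun x => metric M (c, d) x (rshift n k) (rshift n l)) =
      (fun x => ((f \o chart_inv (atlas B c)) \o lsubmx) x *
         (((f \o chart_inv (atlas B c)) \o lsubmx) x *
          ((fun x => metric F d x k l) \o rsubmx) x)).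
      by apply/funext => x; rewrite /= block_mxEdr mxE expr2 mulrA.
    move=> r; have Cf := smooth_on_lsubmx Al (fC c) r.
    apply: class_CM => //; apply: class_CM => //.
    exact: smooth_on_rsubmx Ar (gF d k l) r.
- move=> [c d] x; rewrite prod_chart_cod => -[/= cx dx].
  by rewrite tr_block_mx !trmx0 linearZ /= symB // symF.
- move=> [c d] [c' d'] x; rewrite prod_chart_overlap => -[cx dx] J.
  have trf := chart_inv_transition (chB c) (chB c') cx.
  rewrite /J transition_mx_warped /= row_mxKl row_mxKr.
  rewrite -/(transition (atlas B c) (atlas B c') _) trf.
  rewrite -/(transition (atlas F d) (atlas F d') _).
  rewrite tr_block_mx !trmx0 !mulmx_block !(mulmx0, mul0mx, addr0, add0r).
  by rewrite -scalemxAr -scalemxAl -(compB c c' _ cx) -(compF d d' _ dx).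
- exists (row_mx sB sF).
    by move=> i; case: (split_ordP i) => j ->; rewrite ?row_mxEl ?row_mxEr.
  move=> [c d] x; rewrite prod_chart_cod => -[/= cx dx].
  have [P Pu PB] := frB c _ cx; have [Q Qu QF] := frF d _ dx.
  set fx := f _; have fx0 : fx != 0 by exact: f0.
  (* Dividing the fibre frame by f cancels the factor f^2 of the fibre metric, so the signs of the
     two factors are simply concatenated. *)
  exists (block_mx P 0 0 (fx^-1 *: Q)).
    by rewrite block_diag_mx_unit Pu unitmxZ ?unitfE ?invr_eq0.
  rewrite tr_block_mx !trmx0 !mulmx_block.
  rewrite !(mulmx0, mul0mx, addr0, add0r) PB diag_mx_row.
  by rewrite congruence_scale QF exprVn mulVf ?expf_neq0 // scale1r.
Qed.

End SemiRiemannianWarped.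

Section ConformalChange.
Variables (R : realType) (m : nat) (M : pre_semi_riemannian R m) (phi : M -> R).

Lemma semi_riemannian_conformal :
  (forall p, phi p != 0) ->
  (forall c, smooth_on (chart_cod (atlas M c)) (phi \o chart_inv (atlas M c))) ->
  semi_riemannian M -> semi_riemannian (conformal_change phi).
Proof.
move=> phi0 phiC [mM [gM symM compM [s s1 frM]]].
have chM c : is_chart (atlas M c) by case: mM => -[].
split=> //; split.
- move=> c i j k /=; have [_ oc _ _ _] := chM c.
  have Cphi : class_C k (chart_cod (atlas M c))
      (fun x => (phi (chart_inv (atlas M c) x))^-1).
    by apply: class_CV (phiC c k) => // x _; exact: phi0.
  apply: eq_class_C (class_CM _ Cphi (class_CM _ Cphi (gM c i j k))) => // x _.
  by rewrite mxE mulrA -invfM -expr2.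
- by move=> c x cx; rewrite /= linearZ /= symM.
- move=> c d x cdx J; rewrite /= -scalemxAr -scalemxAl.
  rewrite [metric M c x](compM c d) //.
  by rewrite -(chart_inv_transition (chM c) (chM d) cdx).
- exists s => // c x cx; have [P Pu PM] := frM c x cx.
  have phix := phi0 (chart_inv (atlas M c) x).
  exists (phi (chart_inv (atlas M c) x) *: P); first by rewrite unitmxZ ?unitfE.
  by rewrite congruence_scale PM mulfV ?expf_neq0 // scale1r.
Qed.

End ConformalChange.

Lemma semi_riemannian_pseudo_euclidean (R : realType) (m : nat) (eps : 'I_m -> R) :
  (forall i, eps i = 1 \/ eps i = -1) -> semi_riemannian (pseudo_euclidean eps).
Proof.
move=> eps1; split.
  split; last by move=> c d a k; exact: class_C_coord.
  split.
  - exact: norm_hausdorff.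
  - exact: second_countable_rV.
  - by exists 0.
  - by move=> p; exists tt.
  - have codT : chart_cod (euclid_chart R m) = setT.
      by apply/seteqP; split=> // x _; exists x.
    move=> c; split=> //=; rewrite ?codT; [exact: openT|exact: openT| |].
      by move=> p _; exact: cvg_id.
    by move=> p _; exact: cvg_id.
split.
- by move=> c i j k; exact: class_C_cst.
- by move=> c x _; rewrite /= tr_diag_mx.
- move=> c d x _ J; suff -> : J = 1%:M by rewrite trmx1 mulmx1 mul1mx.
  apply/matrixP => i a; rewrite !mxE /pderiv.
  have [_ ->] := is_derive_coord a x (delta_mx 0 i).
  by rewrite mxE eqxx eq_sym.
- exists (\row_i eps i) => [i|c x _]; first by rewrite mxE.
  by exists 1%:M; rewrite ?unitmx1 // trmx1 mulmx1 mul1mx.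
Qed.

(** * Sums with Kronecker deltas and derivatives of products *)

Section DeltaSums.
Variables (R : comNzRingType) (n : nat).

Lemma sumr_cst (c : R) : \sum_(i < n) c = n%:R * c.
Proof. by rewrite sumr_const card_ord mulr_natl. Qed.

Lemma sum_delta (k : 'I_n) (u : 'I_n -> R) : \sum_l (k == l)%:R * u l = u k.
Proof.
rewrite (bigD1 k) //= eqxx mul1r big1 ?addr0 // => l lk.
by rewrite eq_sym (negPf lk) mul0r.
Qed.

Variables (eps alpha : 'I_n -> R).
Hypothesis eps2 : forall i, eps i * eps i = 1.

Let N := \sum_(i < n) eps i * alpha i ^+ 2.

(** For flat g, the metric e^(2w) g has Christoffel symbols linear in dw. Here w = - log phi, so dw
    = -(phi'/phi) alpha, and this is what multiplies phi'/phi. *)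
Definition conf_coef (k i j : 'I_n) : R :=
  (i == j)%:R * (eps k * eps i * alpha k) - (j == k)%:R * alpha i
    - (i == k)%:R * alpha j.

Lemma conf_coef_diag i k : conf_coef i i k = - alpha k.
Proof.
rewrite /conf_coef eqxx mul1r [k == i]eq_sym.
have [->|_] := eqVneq i k; last by rewrite !mul0r subr0 add0r.
by rewrite eps2 !mul1r subrr add0r.
Qed.

(** This contraction with the differential of xi occurs in the Hessian of any function of xi and in
    both kinds of trace terms of the Ricci tensor of the base block. *)
Lemma sum_conf_coef j k : \sum_i alpha i * conf_coef i j k =
  (j == k)%:R * eps j * N - 2 * alpha j * alpha k.
Proof.
transitivity ((j == k)%:R * eps j * N - \sum_i (k == i)%:R * (alpha i * alpha j)
   - \sum_i (j == i)%:R * (alpha i * alpha k)).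
  by rewrite /N big_distrr -!sumrB; apply: eq_bigr => i _ /=; rewrite /conf_coef; ring.
by rewrite !sum_delta; ring.
Qed.

(** This is the term of the Ricci tensor that is quadratic in the Christoffel symbols and does not
    reduce to a trace of them. *)
Lemma sum_conf_coefM j k : \sum_i \sum_s conf_coef i j s * conf_coef s i k =
  (n%:R + 2) * alpha j * alpha k - 2 * (j == k)%:R * eps j * N.
Proof.
have sum_s i : \sum_s conf_coef i j s * conf_coef s i k =
    (k == i)%:R * (alpha i * alpha j) - (j == k)%:R * eps j * (eps i * alpha i ^+ 2)
    - (j == i)%:R * (alpha i * alpha k) + alpha j * alpha k
    - (j == i)%:R * ((i == k)%:R * eps i * N - 2 * alpha i * alpha k).
  transitivity (\sum_s (j == s)%:R * (eps i * eps j * alpha i * conf_coef s i k)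
    - \sum_s (i == s)%:R * (alpha j * conf_coef s i k)
    - (j == i)%:R * \sum_s alpha s * conf_coef s i k).
    rewrite big_distrr -!sumrB; apply: eq_bigr => s _ /=.
    by rewrite {1}/conf_coef [s == i]eq_sym; ring.
  rewrite !sum_delta sum_conf_coef conf_coef_diag /conf_coef.
  have -> : eps i * eps j * alpha i * ((i == k)%:R * (eps j * eps i * alpha j)
      - (k == j)%:R * alpha i - (i == j)%:R * alpha k) =
    (eps i * eps i) * (eps j * eps j) * (i == k)%:R * alpha i * alpha j
     - (k == j)%:R * eps j * (eps i * alpha i ^+ 2)
     - (i == j)%:R * (eps i * eps j) * alpha i * alpha k by ring.
  have -> : (i == j)%:R * (eps i * eps j) = (i == j)%:R.
    by have [->|_] := eqVneq i j; rewrite ?mul0r // mul1r eps2.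
  by rewrite !eps2 [k == i]eq_sym [k == j]eq_sym [i == j]eq_sym; ring.
rewrite (eq_bigr _ (fun i _ => sum_s i)) !(sumrB, big_split) /= !sum_delta.
rewrite -big_distrr /= -/N sumr_cst; ring.
Qed.

End DeltaSums.

Section DeriveProduct.
Variables (R : realType) (V : normedModType R).
Implicit Types (u w : V -> R) (x v : V).

Lemma is_derive_mul u w x v (du dw : R) : is_derive x v u du -> is_derive x v w dw ->
  is_derive x v (fun y => u y * w y) (du * w x + u x * dw).
Proof.
move=> [d1 <-] [d2 <-]; apply: DeriveDef; first exact: derivableM d1 d2.
by rewrite (deriveM d1 d2) addrC [in RHS]mulrC.
Qed.

Lemma is_derive_div u w x v (du dw : R) : w x != 0 ->
  is_derive x v u du -> is_derive x v w dw ->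
  is_derive x v (fun y => u y / w y) (du / w x - u x * dw / w x ^+ 2).
Proof.
move=> w0 [d1 <-] [d2 <-]; have dV := derivableV w0 d2.
apply: DeriveDef; first exact: derivableM d1 dV.
rewrite (deriveM d1 dV) (deriveV w0 d2) addrC; congr (_ + _); first exact: mulrC.
by rewrite scaleNr scalerN -[X in - X]/(u x * (_ * _)); congr (- _); ring.
Qed.

End DeriveProduct.

Section Derive1.
Variable R : realType.
Implicit Types u : R -> R.

Lemma is_derive1_smooth u (t : R) : smooth1 u -> is_derive t 1 u (u^`()%classic t).
Proof. by move=> su; rewrite derive1E; apply: derivableP; exact: (su 0). Qed.

Lemma is_derive1_smooth2 u (t : R) : smooth1 u ->
  is_derive t 1 (u^`()%classic) (u^`(2)%classic t).
Proof. by move=> /smooth1_derive1 /is_derive1_smooth; rewrite derive1nS derive1n1. Qed.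

End Derive1.

Section SeparateVariables.
Variables (R : realType) (n m : nat) (alpha : 'I_n -> R).
Implicit Types (g : R -> R) (u : 'rV[R]_m -> R) (x : 'rV[R]_(n + m)).

(** The nonconstant entries of the metric and the Christoffel symbols to be differentiated separate
    as a function of xi times a function on the fibre; a base direction sees only the first
    factor. *)
Lemma pderiv_sep_l g u i x dg : is_derive (linform alpha (lsubmx x)) 1 g dg ->
  pderiv (lshift m i) (fun y => g (linform alpha (lsubmx y)) * u (rsubmx y)) x =
  alpha i * dg * u (rsubmx x).
Proof.
move=> [dg1 dgE].
have [d1 d2] := is_derive_ridge (lsubmx (delta_mx 0 (lshift m i))) dg1.
rewrite /pderiv (@deriveM _ _ (g \o linform alpha \o lsubmx) (u \o rsubmx)); last first.
- apply/(@derivable_comp_linear R 'rV[R]_(n + m) 'rV[R]_m rsubmx).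
  by rewrite /= delta_mx_lshift row_mxKr; exact: derivable0.
- by apply/(@derivable_comp_linear R 'rV[R]_(n + m) 'rV[R]_n lsubmx).
have -> : 'D_'e_(lshift m i) (u \o rsubmx) x = 0 by exact: pderiv_rsubmx_lshift.
rewrite scaler0 add0r.
rewrite (@derive_comp_linear R 'rV[R]_(n + m) 'rV[R]_n lsubmx) /= d2.
by rewrite delta_mx_lshift row_mxKl linform_delta derive1E dgE [LHS]mulrC.
Qed.

Lemma pderiv_sep_r g u a x : derivable u (rsubmx x) (delta_mx 0 a) ->
  pderiv (rshift n a) (fun y => g (linform alpha (lsubmx y)) * u (rsubmx y)) x =
  g (linform alpha (lsubmx x)) * pderiv a u (rsubmx x).
Proof.
move=> du.
rewrite /pderiv (@deriveM _ _ (g \o linform alpha \o lsubmx) (u \o rsubmx)); last first.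
- apply/(@derivable_comp_linear R 'rV[R]_(n + m) 'rV[R]_m rsubmx).
  by rewrite /= delta_mx_rshift row_mxKr.
- apply/(@derivable_comp_linear R 'rV[R]_(n + m) 'rV[R]_n lsubmx).
  by rewrite /= delta_mx_rshift row_mxKl; exact: derivable0.
have -> : 'D_'e_(rshift n a) (g \o linform alpha \o lsubmx) x = 0.
  exact: (pderiv_lsubmx_rshift (g \o linform alpha)).
rewrite scaler0 addr0.
by rewrite -[X in _ *: X]/(pderiv (rshift n a) (u \o rsubmx) x) pderiv_rsubmx_rshift.
Qed.

End SeparateVariables.

(** Take i with [alpha i] nonzero and any other index k, either 0 or 1. If [alpha k] vanishes, the
    entry (k, k) kills e and then (i, i) kills s; otherwise the entry (i, k) kills s and then (i, i)
    kills e. *)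
Lemma rank_one_plus_diag_eq0 (R : idomainType) (n : nat) (eps alpha : 'I_n -> R)
    (s e : R) :
  (1 < n)%N -> (forall i, eps i != 0) -> (exists i, alpha i <> 0) ->
  (forall j k, alpha j * alpha k * s + (j == k)%:R * eps j * e = 0) ->
  s = 0 /\ e = 0.
Proof.
move=> n1 eps0 [i /eqP ai] eqs.
have [k ki] : exists k : 'I_n, k != i.
  have [i0|i0] := eqVneq (val i) 0%N.
    by exists (Ordinal n1); rewrite -val_eqE /= i0.
  by exists (Ordinal (ltnW n1)); rewrite -val_eqE /= eq_sym.
have kk := eqs k k; have ii := eqs i i; have ik := eqs i k.
rewrite eqxx mul1r in kk; rewrite eqxx mul1r in ii.
rewrite [i == k]eq_sym (negPf ki) !mul0r addr0 in ik.
have [ak|ak] := eqVneq (alpha k) 0.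
  rewrite ak !mul0r add0r in kk.
  move/eqP: kk; rewrite mulf_eq0 (negPf (eps0 k)) /= => /eqP e0; split=> //.
  rewrite e0 mulr0 addr0 in ii.
  by move/eqP: ii; rewrite !mulf_eq0 (negPf ai) /= => /eqP.
move/eqP: ik; rewrite !mulf_eq0 (negPf ai) (negPf ak) /= => /eqP s0; split=> //.
rewrite s0 mulr0 add0r in ii.
by move/eqP: ii; rewrite mulf_eq0 (negPf (eps0 i)) => /eqP.
Qed.

(** A nonzero entry of g_F is what allows the scalar equation to be read off from the fibre
    block. *)
Lemma unitmx_entry_neq0 (R : comUnitRingType) (m : nat) (G : 'M[R]_m) : (0 < m)%N ->
  (1 : R) != 0 -> G \in unitmx -> exists c d, G c d != 0.
Proof.
move=> m0 R1 Gu; apply: contrapT => noG.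
have G0 : G = 0.
  apply/matrixP => c d; rewrite mxE; apply/eqP; apply: contrapT => /negP Gcd.
  by apply: noG; exists c, d.
have := mulmxV Gu; rewrite {1}G0 mul0mx => /matrixP/(_ (Ordinal m0) (Ordinal m0)).
by rewrite !mxE eqxx => /esym/eqP; rewrite (negPf R1).
Qed.

Lemma forall_split (n m : nat) (P : 'I_(n + m) -> Prop) :
  (forall i, P (lshift m i)) -> (forall a, P (rshift n a)) -> forall i, P i.
Proof. by move=> Pl Pr i; case: (split_ordP i) => j ->. Qed.

(** * Curvature of the warped metric *)

Section WarpedCurvature.
Variables (R : realType) (n m : nat) (eps alpha : 'I_n -> R).
Hypothesis eps2 : forall i, eps i * eps i = 1.
Variables (f phi : R -> R).
Hypotheses (f_smooth : smooth1 f) (phi_smooth : smooth1 phi).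
Hypotheses (f0 : forall t, f t != 0) (phi0 : forall t, phi t != 0).
Variables (G : 'rV[R]_m -> 'M[R]_m) (A : set 'rV[R]_m).
Hypotheses (oA : open A) (GC : forall a b, class_C 1 A (fun y => G y a b)).
Hypotheses (Gu : forall y, A y -> G y \in unitmx).
Hypotheses (Gsym : forall y, A y -> (G y)^T = G y).

Local Notation xi x := (linform alpha (lsubmx x)).
Local Notation N := (\sum_(i < n) eps i * alpha i ^+ 2).
Local Notation C := (conf_coef eps alpha).

Definition warped_mx (x : 'rV[R]_(n + m)) : 'M[R]_(n + m) :=
  block_mx (phi (xi x) ^- 2 *: diag_mx (\row_i eps i)) 0
    0 (f (xi x) ^+ 2 *: G (rsubmx x)).

Let W := warped_mx.

Let f1 : R -> R := f^`()%classic.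
Let phi1 : R -> R := phi^`()%classic.
Let f2 : R -> R := f^`(2)%classic.
Let phi2 : R -> R := phi^`(2)%classic.

Definition conf_rate (t : R) : R := phi1 t / phi t.
Definition warp_rate (t : R) : R := f1 t / f t.
(** It comes from raising an index of the base gradient of f^2/2: the inverse base metric supplies
    phi^2 and the derivative supplies f f'. *)
Definition fibre_rate (t : R) : R := phi t * phi t * (f t * f1 t).

Lemma is_derive_conf_rate (t : R) :
  is_derive t 1 conf_rate (phi2 t / phi t - phi1 t * phi1 t / phi t ^+ 2).
Proof.
exact: is_derive_div (phi0 t) (is_derive1_smooth2 t phi_smooth)
  (is_derive1_smooth t phi_smooth).
Qed.

Lemma is_derive_warp_rate (t : R) :
  is_derive t 1 warp_rate (f2 t / f t - f1 t * f1 t / f t ^+ 2).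
Proof.
exact: is_derive_div (f0 t) (is_derive1_smooth2 t f_smooth)
  (is_derive1_smooth t f_smooth).
Qed.

Lemma is_derive_fibre_rate (t : R) : is_derive t 1 fibre_rate
  (2 * phi t * phi1 t * (f t * f1 t)
   + phi t ^+ 2 * (f1 t ^+ 2 + f t * f2 t)).
Proof.
have dphi := is_derive1_smooth t phi_smooth; have df := is_derive1_smooth t f_smooth.
have := is_derive_mul (is_derive_mul dphi dphi)
  (is_derive_mul df (is_derive1_smooth2 t f_smooth)).
by move=> /is_derive_eq; apply; rewrite /f1 /f2 /phi1; ring.
Qed.

(** This carries identities for Christoffel symbols, valid over [A] only, to their partial
    derivatives. *)
Lemma pderiv_near I (u v : 'rV[R]_(n + m) -> R) x :
  (forall y, A (rsubmx y) -> u y = v y) ->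
  A (rsubmx x) -> pderiv I u x = pderiv I v x :> R.
Proof.
move=> uv Ax; apply: near_eq_derive.
have oB : open (rsubmx @^-1` A : set 'rV[R]_(n + m)).
  by apply: open_comp => // y _; exact: continuous_rsubmx.
by apply: filterS (open_nbhs_nbhs (conj oB Ax)).
Qed.

Lemma pderiv_cst I (c : R) (x : 'rV[R]_(n + m)) : pderiv I (fun=> c) x = 0.
Proof. exact: derive_cst. Qed.

Lemma pderiv_xi_lshift (g : R -> R) (dg c : R) i (x : 'rV[R]_(n + m)) :
  is_derive (xi x) 1 g dg ->
  pderiv (lshift m i) (fun y => g (xi y) * c) x = alpha i * dg * c.
Proof. by move=> dgx; exact: (pderiv_sep_l (cst c) i dgx). Qed.

Lemma pderiv_xi_rshift (g : R -> R) (c : R) a (x : 'rV[R]_(n + m)) :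
  pderiv (rshift n a) (fun y => g (xi y) * c) x = 0.
Proof. exact: (pderiv_lsubmx_rshift (fun z => g (linform alpha z) * c)). Qed.

Lemma metricE_ll i j x : W x (lshift m i) (lshift m j) =
  phi (xi x) ^- 2 * ((i == j)%:R * eps i).
Proof. by rewrite block_mxEul !mxE mulr_natl. Qed.

Lemma metricE_rr a b x : W x (rshift n a) (rshift n b) =
  f (xi x) ^+ 2 * G (rsubmx x) a b.
Proof. by rewrite block_mxEdr mxE. Qed.

Lemma metricE_lr i a x : W x (lshift m i) (rshift n a) = 0.
Proof. by rewrite block_mxEur mxE. Qed.

Lemma metricE_rl i a x : W x (rshift n a) (lshift m i) = 0.
Proof. by rewrite block_mxEdl mxE. Qed.

Lemma pderiv_metric_lr I i a x :
  pderiv I (fun y => W y (lshift m i) (rshift n a)) x = 0.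
Proof. by under eq_fun do rewrite metricE_lr; exact: pderiv_cst. Qed.

Lemma pderiv_metric_rl I i a x :
  pderiv I (fun y => W y (rshift n a) (lshift m i)) x = 0.
Proof. by under eq_fun do rewrite metricE_rl; exact: pderiv_cst. Qed.

Lemma pderiv_metric_l_ll k i j x :
  pderiv (lshift m k) (fun y => W y (lshift m i) (lshift m j)) x =
  alpha k * (- 2 * conf_rate (xi x) / phi (xi x) ^+ 2) * ((i == j)%:R * eps i).
Proof.
under eq_fun do rewrite metricE_ll.
apply: (@pderiv_xi_lshift (fun t => phi t ^- 2)).
have dphi := is_derive1_smooth (xi x) phi_smooth.
have p0 : phi (xi x) * phi (xi x) != 0 by rewrite mulf_neq0.
have := is_derive_div (w := fun s => phi s * phi s) p0
  (is_derive_cst (1 : R) (xi x : R) (1 : R)) (is_derive_mul dphi dphi).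
have -> : (fun s => cst 1 s / (phi s * phi s)) = (fun t => phi t ^- 2).
  by apply/funext => s; rewrite /= mul1r expr2.
by move=> /is_derive_eq; apply; rewrite /cst /conf_rate /phi1; field; exact: phi0.
Qed.

Lemma pderiv_metric_r_ll a i j x :
  pderiv (rshift n a) (fun y => W y (lshift m i) (lshift m j)) x = 0.
Proof.
under eq_fun do rewrite metricE_ll.
exact: (pderiv_xi_rshift (fun t => phi t ^- 2)).
Qed.

Lemma pderiv_metric_l_rr i a b x :
  pderiv (lshift m i) (fun y => W y (rshift n a) (rshift n b)) x =
  alpha i * (2 * f (xi x) ^+ 2 * warp_rate (xi x)) * G (rsubmx x) a b.
Proof.
under eq_fun do rewrite metricE_rr.
apply: (@pderiv_sep_l _ _ _ _ (fun t => f t ^+ 2) (fun y => G y a b)).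
have df := is_derive1_smooth (xi x) f_smooth.
have := is_derive_mul df df; move=> /is_derive_eq; apply.
rewrite /warp_rate /f1; field; exact: f0.
Qed.

Lemma pderiv_metric_r_rr c a b x : A (rsubmx x) ->
  pderiv (rshift n c) (fun y => W y (rshift n a) (rshift n b)) x =
  f (xi x) ^+ 2 * pderiv c (fun y => G y a b) (rsubmx x).
Proof.
move=> Ax; under eq_fun do rewrite metricE_rr.
apply: (@pderiv_sep_r _ _ _ _ (fun t => f t ^+ 2) (fun y => G y a b)).
by have [_ dG] := GC a b; have [dGc _] := dG c; exact: dGc.
Qed.

(** A diagonal matrix of signs is its own inverse, so the candidate is explicit, and for square
    matrices one product equal to the identity suffices. *)
Lemma invmx_metric x : A (rsubmx x) -> invmx (W x) =
  block_mx (phi (xi x) ^+ 2 *: diag_mx (\row_i eps i)) 0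
    0 (f (xi x) ^- 2 *: invmx (G (rsubmx x))).
Proof.
move=> Ax; set V := block_mx _ _ _ _.
have WV : W x *m V = 1%:M.
  rewrite mulmx_block !(mulmx0, mul0mx, addr0, add0r) -!scalemxAl -!scalemxAr.
  rewrite !scalerA mulVf ?expf_neq0 // mulfV ?expf_neq0 // !scale1r.
  rewrite mulmxV ?Gu // mul_mx_diag [RHS]scalar_mx_block; congr block_mx.
  apply/matrixP => i j; rewrite !mxE.
  by have [->|_] := eqVneq i j; rewrite ?mul0r // mulr1n eps2.
have [Wu _] := mulmx1_unit WV.
by rewrite -[LHS]mulmx1 -WV mulKmx.
Qed.

(** * Christoffel symbols of the warped metric *)

Section Point.
Variable x : 'rV[R]_(n + m).
Hypothesis Ax : A (rsubmx x).
Local Notation GF := (G (rsubmx x)).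

(** The inverse metric is block diagonal and its base block is diagonal, so a single term of the
    contraction survives. *)
Lemma christoffel_l k I J : christoffel W (lshift m k) I J x =
  2^-1 * phi (xi x) ^+ 2 * eps k *
   (pderiv I (fun y => W y J (lshift m k)) x
    + pderiv J (fun y => W y I (lshift m k)) x
    - pderiv (lshift m k) (fun y => W y I J) x).
Proof.
rewrite /christoffel invmx_metric // big_split_ord /= [X in _ + X]big1 ?addr0.
  pose D l := pderiv I (fun y => W y J l) x + pderiv J (fun y => W y I l) x
    - pderiv l (fun y => W y I J) x.
  transitivity (2^-1 * \sum_l (k == l)%:R * (phi (xi x) ^+ 2 * eps k * D (lshift m l))).
    congr (_ * _); apply: eq_bigr => l _.
    by rewrite block_mxEul !mxE -mulr_natl -/(D _); ring.
  by rewrite sum_delta /D !mulrA.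
by move=> l _; rewrite block_mxEur mxE mul0r.
Qed.

Lemma christoffel_r a I J : christoffel W (rshift n a) I J x =
  2^-1 * f (xi x) ^- 2 * \sum_d invmx GF a d *
   (pderiv I (fun y => W y J (rshift n d)) x
    + pderiv J (fun y => W y I (rshift n d)) x
    - pderiv (rshift n d) (fun y => W y I J) x).
Proof.
rewrite /christoffel invmx_metric // big_split_ord /= [X in X + _]big1 ?add0r.
  rewrite -!mulrA; congr (_ * _); rewrite big_distrr /=.
  by apply: eq_bigr => l _; rewrite block_mxEdr mxE mulrA.
by move=> l _; rewrite block_mxEdl mxE mul0r.
Qed.

Lemma christoffel_lll k i j :
  christoffel W (lshift m k) (lshift m i) (lshift m j) x =
  conf_rate (xi x) * C k i j.
Proof.
rewrite christoffel_l !pderiv_metric_l_ll /conf_coef.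
(* On the support of each Kronecker delta the signs may be exchanged; they then meet in pairs
   [eps k * eps k], which equal 1. *)
have -> : (j == k)%:R * eps j = (j == k)%:R * eps k.
  by have [->|] := eqVneq j k; rewrite ?mul0r.
have -> : (i == k)%:R * eps i = (i == k)%:R * eps k.
  by have [->|] := eqVneq i k; rewrite ?mul0r.
have p0 := phi0 (xi x).
transitivity (conf_rate (xi x) * ((i == j)%:R * (eps k * eps i * alpha k)
  - (eps k * eps k) * (j == k)%:R * alpha i - (eps k * eps k) * (i == k)%:R * alpha j)).
  by field.
by rewrite eps2 !mul1r.
Qed.

Lemma christoffel_llr k i a :
  christoffel W (lshift m k) (lshift m i) (rshift n a) x = 0.
Proof.
rewrite christoffel_l pderiv_metric_rl pderiv_metric_lr pderiv_metric_r_ll.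
by rewrite addr0 subr0 mulr0.
Qed.

Lemma christoffel_lrl k i a :
  christoffel W (lshift m k) (rshift n a) (lshift m i) x = 0.
Proof.
rewrite christoffel_l !pderiv_metric_rl pderiv_metric_r_ll.
by rewrite addr0 subr0 mulr0.
Qed.

Lemma christoffel_lrr k a b :
  christoffel W (lshift m k) (rshift n a) (rshift n b) x =
  - (fibre_rate (xi x) * (eps k * alpha k)) * GF a b.
Proof.
rewrite christoffel_l !pderiv_metric_rl pderiv_metric_l_rr /fibre_rate /warp_rate.
by have := f0 (xi x) => ?; field.
Qed.

Lemma christoffel_rll a i j :
  christoffel W (rshift n a) (lshift m i) (lshift m j) x = 0.
Proof.
rewrite christoffel_r big1 ?mulr0 // => d _.
by rewrite !pderiv_metric_lr pderiv_metric_r_ll addr0 subr0 mulr0.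
Qed.

Lemma christoffel_rlr a i b :
  christoffel W (rshift n a) (lshift m i) (rshift n b) x =
  warp_rate (xi x) * (alpha i * (a == b)%:R).
Proof.
rewrite christoffel_r.
(* Only the base derivative of f^2 g_F survives and it is proportional to g_F; contracted with the
   inverse of g_F it yields the Kronecker delta. *)
transitivity (warp_rate (xi x) * (alpha i * (invmx GF *m GF) a b)); last first.
  by rewrite mulVmx ?Gu // mxE.
rewrite mxE !big_distrr; apply: eq_bigr => d _ /=.
rewrite pderiv_metric_l_rr !pderiv_metric_lr.
have -> : GF b d = GF d b by rewrite -[in LHS]Gsym // mxE.
by have := f0 (xi x) => ?; field.
Qed.

Lemma christoffel_rrl a i b :
  christoffel W (rshift n a) (rshift n b) (lshift m i) x =
  warp_rate (xi x) * (alpha i * (a == b)%:R).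
Proof.
rewrite -christoffel_rlr !christoffel_r; congr (_ * _); apply: eq_bigr => d _.
by rewrite !pderiv_metric_lr pderiv_metric_rl add0r addr0.
Qed.

(** In fibre directions f is constant, so the f^2 of the metric cancels against the f^-2 of its
    inverse. *)
Lemma christoffel_rrr a b c :
  christoffel W (rshift n a) (rshift n b) (rshift n c) x =
  christoffel G a b c (rsubmx x).
Proof.
rewrite christoffel_r [RHS]/christoffel -mulrA big_distrr /=; congr (_ * _).
apply: eq_bigr => d _; rewrite !pderiv_metric_r_rr //.
by have := f0 (xi x) => ?; field.
Qed.

(** [ricci_rl] needs this: there the two terms that should cancel carry the lower indices in
    opposite orders. *)
Lemma christoffel_sym a b c :
  christoffel G a b c (rsubmx x) = christoffel G a c b (rsubmx x).
Proof.
rewrite /christoffel; congr (_ * _); apply: eq_bigr => d _; congr (_ * _).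
rewrite [X in X - _]addrC; congr (_ - _); apply: near_eq_derive.
apply: filterS (open_nbhs_nbhs (conj oA Ax)) => y Ay.
by rewrite -[in LHS]Gsym // mxE.
Qed.

End Point.

(** * Ricci tensor of the warped metric *)

Section Ricci.
Variable x : 'rV[R]_(n + m).
Hypothesis Ax : A (rsubmx x).
Local Notation GF := (G (rsubmx x)).

(** [a1], [b1] and [q1] are the derivatives of the three rates [a], [b] and [q]. Second derivatives
    enter through a1 + a^2 = phi''/phi and b1 + b^2 = f''/f. *)
Let a1 := phi2 (xi x) / phi (xi x) - phi1 (xi x) * phi1 (xi x) / phi (xi x) ^+ 2.
Let b1 := f2 (xi x) / f (xi x) - f1 (xi x) * f1 (xi x) / f (xi x) ^+ 2.
Let q1 := 2 * phi (xi x) * phi1 (xi x) * (f (xi x) * f1 (xi x))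
   + phi (xi x) ^+ 2 * (f1 (xi x) ^+ 2 + f (xi x) * f2 (xi x)).
Local Notation a := (conf_rate (xi x)).
Local Notation b := (warp_rate (xi x)).
Local Notation q := (fibre_rate (xi x)).

Lemma pderiv_christoffel_l_lll l k i j :
  pderiv (lshift m l) (christoffel W (lshift m k) (lshift m i) (lshift m j)) x
  = alpha l * a1 * C k i j.
Proof.
rewrite (pderiv_near _ (fun y Ay => christoffel_lll Ay k i j) Ax).
exact: pderiv_xi_lshift (is_derive_conf_rate _).
Qed.

Lemma pderiv_christoffel_r_lll c k i j :
  pderiv (rshift n c) (christoffel W (lshift m k) (lshift m i) (lshift m j)) x = 0.
Proof.
rewrite (pderiv_near _ (fun y Ay => christoffel_lll Ay k i j) Ax).
exact: pderiv_xi_rshift.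
Qed.

Lemma pderiv_christoffel_l_lrr l k c d :
  pderiv (lshift m l) (christoffel W (lshift m k) (rshift n c) (rshift n d)) x
  = - (alpha l * q1 * (eps k * alpha k) * GF c d).
Proof.
rewrite (pderiv_near _ (v := fun y =>
  fibre_rate (xi y) * (- (eps k * alpha k) * G (rsubmx y) c d))) //.
  rewrite (pderiv_sep_l (fun y => - (eps k * alpha k) * G y c d) l
    (is_derive_fibre_rate _)) -/q1; ring.
by move=> y Ay; rewrite christoffel_lrr //; ring.
Qed.

Lemma pderiv_christoffel_r_rlr e c i d :
  pderiv (rshift n e) (christoffel W (rshift n c) (lshift m i) (rshift n d)) x = 0.
Proof.
rewrite (pderiv_near _ (fun y Ay => christoffel_rlr Ay c i d) Ax).
exact: pderiv_xi_rshift.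
Qed.

Lemma pderiv_christoffel_l_rrl l c i d :
  pderiv (lshift m l) (christoffel W (rshift n c) (rshift n d) (lshift m i)) x
  = alpha l * b1 * (alpha i * (c == d)%:R).
Proof.
rewrite (pderiv_near _ (fun y Ay => christoffel_rrl Ay c i d) Ax).
exact: pderiv_xi_lshift (is_derive_warp_rate _).
Qed.

Lemma pderiv_christoffel_r_rrl e c i d :
  pderiv (rshift n e) (christoffel W (rshift n c) (rshift n d) (lshift m i)) x = 0.
Proof.
rewrite (pderiv_near _ (fun y Ay => christoffel_rrl Ay c i d) Ax).
exact: pderiv_xi_rshift.
Qed.

Lemma pderiv_christoffel_l_rrr l c d e :
  pderiv (lshift m l) (christoffel W (rshift n c) (rshift n d) (rshift n e)) x = 0.
Proof.
rewrite (pderiv_near _ (fun y Ay => christoffel_rrr Ay c d e) Ax).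
exact: (pderiv_rsubmx_lshift (christoffel G c d e)).
Qed.

Lemma pderiv_christoffel_r_rrr g c d e :
  pderiv (rshift n g) (christoffel W (rshift n c) (rshift n d) (rshift n e)) x
  = pderiv g (christoffel G c d e) (rsubmx x).
Proof.
rewrite (pderiv_near _ (fun y Ay => christoffel_rrr Ay c d e) Ax).
exact: (pderiv_rsubmx_rshift (christoffel G c d e)).
Qed.

Lemma pderiv_christoffel_0 I K L J :
  (forall y, A (rsubmx y) -> christoffel W K L J y = 0) ->
  pderiv I (christoffel W K L J) x = 0.
Proof. by move=> G0; rewrite (pderiv_near I G0 Ax); exact: pderiv_cst. Qed.

(** The trace is split into base and fibre indices. All m fibre indices contribute the same amount,
    and the base indices reduce to the contractions of [conf_coef] computed above. *)
Lemma ricci_ll j k : ricci W (lshift m j) (lshift m k) x =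
  (j == k)%:R * eps j * N * (a1 - n%:R * a ^+ 2 + 2 * a ^+ 2 + m%:R * (a * b))
  + alpha j * alpha k * ((n%:R - 2) * (a1 + a ^+ 2) - m%:R * (b1 + b ^+ 2 + 2 * a * b)).
Proof.
have base i : riemann W (lshift m i) (lshift m k) (lshift m i) (lshift m j) x =
    a1 * (alpha i * C i j k) + a1 * (alpha j * alpha k)
    - a ^+ 2 * (\sum_s alpha s * C s j k)
    - a ^+ 2 * (\sum_s C i j s * C s i k).
  rewrite /riemann !pderiv_christoffel_l_lll conf_coef_diag // big_split_ord /=.
  rewrite [X in _ + (_ + X)]big1; last first.
    by move=> c _; rewrite !christoffel_llr // !mul0r subrr.
  rewrite (eq_bigr (fun s => - (a ^+ 2 * (alpha s * C s j k))
      - a ^+ 2 * (C i j s * C s i k))); last first.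
    by move=> s _; rewrite !christoffel_lll // conf_coef_diag //; ring.
  rewrite sumrB sumrN -!big_distrr /=; ring.
have fibre c : riemann W (rshift n c) (lshift m k) (rshift n c) (lshift m j) x =
    - b1 * (alpha j * alpha k) + a * b * (\sum_s alpha s * C s j k)
    - b ^+ 2 * (alpha j * alpha k).
  rewrite /riemann pderiv_christoffel_0; last by move=> y Ay; exact: christoffel_rll.
  rewrite pderiv_christoffel_l_rrl eqxx big_split_ord /=.
  rewrite (eq_bigr (fun s => a * b * (alpha s * C s j k))); last first.
    move=> s _; rewrite christoffel_rrl // christoffel_lll // christoffel_rll //.
    by rewrite eqxx mulr1; ring.
  rewrite [X in _ + (_ + X)](eq_bigr (fun s => (c == s)%:R *
      (- b ^+ 2 * (alpha j * alpha k) * (s == c)%:R))); last first.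
    move=> s _; rewrite christoffel_rll // christoffel_rlr // christoffel_rrl //.
    by ring.
  rewrite sum_delta eqxx -big_distrr /=; ring.
rewrite /ricci big_split_ord /= (eq_bigr _ (fun i _ => base i)).
rewrite (eq_bigr _ (fun c _ => fibre c)) sumr_cst.
rewrite !(sumrB, big_split) /= -!big_distrr /= sum_conf_coefM // sum_conf_coef //.
rewrite !sumr_cst; ring.
Qed.

(** For each fibre index d two copies of the symbol with indices d, d, c of F, both multiplied by
    [b * alpha j], cancel; the base indices contribute nothing. *)
Lemma ricci_lr j c : ricci W (lshift m j) (rshift n c) x = 0.
Proof.
rewrite /ricci big_split_ord /= !big1 ?addr0 // => [d _|i _].
  rewrite /riemann pderiv_christoffel_r_rlr pderiv_christoffel_l_rrr big_split_ord /=.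
  rewrite big1 => [|s _]; last by rewrite christoffel_llr // christoffel_rll //; ring.
  rewrite (eq_bigr (fun s =>
      (c == s)%:R * (b * alpha j * christoffel G d d s (rsubmx x))
      - (d == s)%:R * (b * alpha j * christoffel G s d c (rsubmx x)))); last first.
    by move=> s _; rewrite !christoffel_rrr // !christoffel_rlr // [s == c]eq_sym; ring.
  rewrite sumrB !sum_delta; ring.
rewrite /riemann !pderiv_christoffel_0; last 2 first.
- by move=> y Ay; exact: christoffel_llr.
- by move=> y Ay; exact: christoffel_llr.
rewrite big_split_ord /= !big1 => [|s _|s _]; first by ring.
  by rewrite !christoffel_llr //; ring.
by rewrite !christoffel_llr //; ring.
Qed.

Lemma ricci_rl c k : ricci W (rshift n c) (lshift m k) x = 0.
Proof.
rewrite /ricci big_split_ord /= !big1 ?addr0 // => [d _|i _].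
  rewrite /riemann !pderiv_christoffel_r_rrl big_split_ord /=.
  rewrite big1 => [|s _]; last by rewrite !christoffel_lrl //; ring.
  rewrite (eq_bigr (fun s =>
      (c == s)%:R * (b * alpha k * christoffel G d d s (rsubmx x))
      - (d == s)%:R * (b * alpha k * christoffel G d c s (rsubmx x)))); last first.
    move=> s _; rewrite !christoffel_rrr // !christoffel_rrl //.
    by rewrite [s == c]eq_sym [s == d]eq_sym; ring.
  rewrite sumrB !sum_delta christoffel_sym //; ring.
rewrite /riemann pderiv_christoffel_0; last by move=> y Ay; exact: christoffel_lrl.
rewrite pderiv_christoffel_r_lll big_split_ord /= !big1 => [|s _|s _]; first by ring.
  by rewrite christoffel_llr // christoffel_rll //; ring.
by rewrite !christoffel_lrl //; ring.
Qed.

(** The purely fibre symbols are those of F, so [ricci G] splits off; every other term contains [q]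
    or [q1] and ends up proportional to [N * GF c d]. *)
Lemma ricci_rr c d : ricci W (rshift n c) (rshift n d) x =
  ricci G c d (rsubmx x) - N * GF c d * (q1 - n%:R * a * q + (m%:R - 2) * b * q).
Proof.
have base i : riemann W (lshift m i) (rshift n d) (lshift m i) (rshift n c) x =
    - (q1 - b * q) * GF c d * (eps i * alpha i ^+ 2) + a * q * GF c d * N.
  rewrite /riemann pderiv_christoffel_l_lrr pderiv_christoffel_0; last first.
    by move=> y Ay; exact: christoffel_llr.
  rewrite big_split_ord /=.
  rewrite (eq_bigr (fun s => a * q * GF c d * (eps s * alpha s ^+ 2))); last first.
    move=> s _; rewrite christoffel_lll // christoffel_lrr // christoffel_lrl //.
    by rewrite conf_coef_diag //; ring.
  rewrite [X in _ + (_ + X)](eq_bigr (fun s => (d == s)%:R *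
      (b * q * (eps i * alpha i ^+ 2) * GF c s))); last first.
    move=> s _; rewrite christoffel_llr // christoffel_lrr // christoffel_rlr //.
    by rewrite [s == d]eq_sym; ring.
  rewrite sum_delta -big_distrr /=; ring.
(* [u], [v] and [S] stand for the three parts of [riemann G], kept opaque for [ring]; the right-hand
   side then matches the goal by unfolding. *)
have regroup (u v w S y1 y2 z e : R) :
    u - v + (- (z * y1 - e * (z * y2)) * w + S) =
    u - v + S - z * w * y1 + e * (z * w * y2) by ring.
have fibre e : riemann W (rshift n e) (rshift n d) (rshift n e) (rshift n c) x =
    riemann G e d e c (rsubmx x) - b * q * N * GF c d
    + (c == e)%:R * (b * q * N * GF e d).
  rewrite /riemann !pderiv_christoffel_r_rrr big_split_ord /=.
  rewrite (eq_bigr (fun s => - (b * q * GF c d - (c == e)%:R * (b * q * GF e d))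
      * (eps s * alpha s ^+ 2))); last first.
    move=> s _; rewrite !christoffel_rrl // !christoffel_lrr //.
    by rewrite eqxx mulr1 [e == c]eq_sym; ring.
  rewrite -big_distrr /=; under [X in _ + (_ + X) = _]eq_bigr => s _.
    rewrite !christoffel_rrr //; over.
  exact: regroup.
rewrite /ricci big_split_ord /= (eq_bigr _ (fun i _ => base i)).
rewrite (eq_bigr _ (fun c _ => fibre c)) big_split /= [X in _ + X]big_split /=.
rewrite sumrB sum_delta !sumr_cst -big_distrr /= -/(ricci G c d (rsubmx x)); ring.
Qed.

End Ricci.

(** * Hessian of a function of xi *)

Section Hessian.
Variables (h : R -> R) (h_smooth : smooth1 h) (x : 'rV[R]_(n + m)).
Hypothesis Ax : A (rsubmx x).
Let u (y : 'rV[R]_(n + m)) : R := h (xi y).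
Local Notation a := (conf_rate (xi x)).

Lemma pderiv_l_u i y : pderiv (lshift m i) u y = alpha i * h^`()%classic (xi y).
Proof.
have := @pderiv_xi_lshift h _ 1 i y (is_derive1_smooth _ h_smooth).
by rewrite mulr1 => <-; rewrite /u; under [in RHS]eq_fun do rewrite mulr1.
Qed.

Lemma pderiv_r_u c y : pderiv (rshift n c) u y = 0.
Proof. exact: (pderiv_lsubmx_rshift (fun z => h (linform alpha z))). Qed.

(** The differential of [u] is h' times that of xi, so only the symbols with a base upper index
    count. *)
Lemma sum_christoffel_pderiv I J : \sum_k christoffel W k I J x * pderiv k u x =
  h^`()%classic (xi x) * \sum_k alpha k * christoffel W (lshift m k) I J x.
Proof.
rewrite big_split_ord /= [X in _ + X]big1 ?addr0 => [|c _].
  by rewrite big_distrr; apply: eq_bigr => k _; rewrite /= pderiv_l_u; ring.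
by rewrite pderiv_r_u mulr0.
Qed.

Lemma hessian_ll i j : hessian W u (lshift m i) (lshift m j) x =
  alpha i * alpha j * (h^`(2)%classic (xi x) + 2 * a * h^`()%classic (xi x))
  - (i == j)%:R * eps i * N * (a * h^`()%classic (xi x)).
Proof.
rewrite /hessian sum_christoffel_pderiv.
have -> : pderiv (lshift m j) u = fun y => h^`()%classic (xi y) * alpha j.
  by apply/funext => y; rewrite pderiv_l_u mulrC.
rewrite (pderiv_xi_lshift _ _ (is_derive1_smooth2 _ h_smooth)).
rewrite (eq_bigr (fun k => a * (alpha k * C k i j))); last first.
  by move=> k _; rewrite christoffel_lll //; ring.
rewrite -big_distrr /= sum_conf_coef //; ring.
Qed.

Lemma hessian_lr i c : hessian W u (lshift m i) (rshift n c) x = 0.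
Proof.
rewrite /hessian sum_christoffel_pderiv.
have -> : pderiv (rshift n c) u = fun=> 0 by apply/funext => y; exact: pderiv_r_u.
rewrite pderiv_cst big1 ?mulr0 ?subr0 // => k _.
by rewrite christoffel_llr // mulr0.
Qed.

Lemma hessian_rl i c : hessian W u (rshift n c) (lshift m i) x = 0.
Proof.
rewrite /hessian sum_christoffel_pderiv.
have -> : pderiv (lshift m i) u = fun y => h^`()%classic (xi y) * alpha i.
  by apply/funext => y; rewrite pderiv_l_u mulrC.
rewrite pderiv_xi_rshift big1 ?mulr0 ?subr0 // => k _.
by rewrite christoffel_lrl // mulr0.
Qed.

(** Since [u] is constant along the fibre, this block comes entirely from the symbols
    [christoffel_lrr]. *)
Lemma hessian_rr c d : hessian W u (rshift n c) (rshift n d) x =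
  N * G (rsubmx x) c d * (fibre_rate (xi x) * h^`()%classic (xi x)).
Proof.
rewrite /hessian sum_christoffel_pderiv.
have -> : pderiv (rshift n d) u = fun=> 0 by apply/funext => y; exact: pderiv_r_u.
rewrite pderiv_cst (eq_bigr (fun k => - (fibre_rate (xi x) * G (rsubmx x) c d)
  * (eps k * alpha k ^+ 2))); last first.
  by move=> k _; rewrite christoffel_lrr //; ring.
rewrite -big_distrr /=; ring.
Qed.

End Hessian.

(** * The quasi-Einstein equation at a point *)

Section QuasiEinstein.
Variables (h : R -> R) (h_smooth : smooth1 h) (h0 : forall t, h t != 0).
Variables (r : nat) (rho lambda : R).
Hypothesis GE : forall y, A y -> forall a b, ricci G a b y = lambda * G y a b.
Let h1 : R -> R := h^`()%classic.
Let h2 : R -> R := h^`(2)%classic.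

(** Up to a nowhere vanishing factor this is the coefficient of [alpha j * alpha k] in the base
    block, hence all that remains there for j <> k; it is not the block mixing base and fibre. *)
Definition qe_mixed (t : R) : R :=
  (n%:R - 2) * f t * h t * phi2 t - r%:R * f t * phi t * h2 t
      - m%:R * h t * phi t * f2 t - 2 * m%:R * h t * phi1 t * f1 t
      - 2 * r%:R * f t * phi1 t * h1 t.

Definition qe_base (t : R) : R :=
  f t * h t * phi t * phi2 t - (n%:R - 1) * f t * h t * phi1 t ^+ 2
    + m%:R * h t * phi t * phi1 t * f1 t + r%:R * f t * phi t * phi1 t * h1 t.

Definition qe_fibre (t : R) : R :=
  - (f t * h t * phi t ^+ 2 * f2 t)
    + (n%:R - 2) * f t * h t * phi t * phi1 t * f1 t
    - (m%:R - 1) * h t * phi t ^+ 2 * f1 t ^+ 2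
    - r%:R * f t * phi t ^+ 2 * f1 t * h1 t.

Local Notation u := (fun y : 'rV[R]_(n + m) => h (linform alpha (lsubmx y))).

Section PointwiseEquations.
Variable x : 'rV[R]_(n + m).
Hypothesis Ax : A (rsubmx x).
Local Notation t := (linform alpha (lsubmx x)).

(** The denominators are those left by the rates and by r/h; the extra phi^2 under the diagonal part
    reflects the factor phi^-2 of the base metric. *)
Lemma qe_eq_ll j k : ricci W (lshift m j) (lshift m k) x
    - r%:R / h t * hessian W u (lshift m j) (lshift m k) x
    - rho * W x (lshift m j) (lshift m k) =
  alpha j * alpha k * (qe_mixed t / (f t * phi t * h t))
  + (j == k)%:R * eps j *
    ((N * qe_base t - rho * f t * h t) / (phi t ^+ 2 * f t * h t)).
Proof.
rewrite ricci_ll // hessian_ll // metricE_ll.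
rewrite /qe_mixed /qe_base /conf_rate /warp_rate.
rewrite -/f1 -/f2 -/phi1 -/phi2 -/h1 -/h2.
have := f0 t; have := phi0 t; have := h0 t => ht pt ft.
by field; rewrite ft pt ht.
Qed.

Lemma qe_eq_rr c d : ricci W (rshift n c) (rshift n d) x
    - r%:R / h t * hessian W u (rshift n c) (rshift n d) x
    - rho * W x (rshift n c) (rshift n d) =
  G (rsubmx x) c d * ((N * qe_fibre t - h t * (rho * f t ^+ 2 - lambda)) / h t).
Proof.
rewrite ricci_rr // hessian_rr // metricE_rr GE //.
rewrite /qe_fibre /conf_rate /warp_rate /fibre_rate.
rewrite -/f1 -/f2 -/phi1 -/phi2 -/h1 -/h2.
have := f0 t; have := phi0 t; have := h0 t => ht pt ft.
by field; rewrite ft pt ht.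
Qed.

Lemma quasi_einstein_at : (1 < n)%N -> (0 < m)%N -> (exists i, alpha i <> 0) ->
  (forall I J, ricci W I J x - r%:R / h t * hessian W u I J x = rho * W x I J) <->
  [/\ qe_mixed t = 0, N * qe_base t = rho * f t * h t &
      N * qe_fibre t = h t * (rho * f t ^+ 2 - lambda)].
Proof.
move=> n1 m0 alpha0; split=> [qe|[mixed base fibre]].
  have [s0 e0] : qe_mixed t / (f t * phi t * h t) = 0 /\
      (N * qe_base t - rho * f t * h t) / (phi t ^+ 2 * f t * h t) = 0.
    apply: (@rank_one_plus_diag_eq0 _ _ eps alpha) => // [i|j k].
      apply: contra_eq_neq (eps2 i) => ->; rewrite mul0r eq_sym; exact: oner_neq0.
    by rewrite -qe_eq_ll qe subrr.
  have [c [d Gcd]] := unitmx_entry_neq0 m0 (oner_neq0 R) (Gu Ax).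
  have := qe_eq_rr c d; rewrite qe subrr => /esym/eqP.
  rewrite mulf_eq0 (negPf Gcd) mulf_eq0 invr_eq0 (negPf (h0 t)) orbF subr_eq0 /=.
  move=> /eqP fibre; split=> //.
    by move/eqP: s0; rewrite mulf_eq0 invr_eq0 !mulf_eq0 (negPf (f0 t))
      (negPf (phi0 t)) (negPf (h0 t)) !orbF => /eqP.
  by move/eqP: e0; rewrite mulf_eq0 invr_eq0 !mulf_eq0 (negPf (f0 t))
      (negPf (phi0 t)) (negPf (h0 t)) !orbF subr_eq0 => /eqP.
apply: forall_split => i; apply: forall_split => j.
- by apply/eqP; rewrite -subr_eq0 qe_eq_ll mixed base subrr !mul0r !mulr0 addr0.
- by rewrite ricci_lr // hessian_lr // metricE_lr !mulr0 subr0.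
- by rewrite ricci_rl // hessian_rl // metricE_rl !mulr0 subr0.
- by apply/eqP; rewrite -subr_eq0 qe_eq_rr fibre subrr mul0r mulr0.
Qed.

End PointwiseEquations.

End QuasiEinstein.

End WarpedCurvature.

(** * From the equations at a point to the equivalence on M *)

Lemma metric_unitmx (R : realType) (m : nat) (F : pre_semi_riemannian R m) c y :
  semi_riemannian F -> chart_cod (atlas F c) y -> metric F c y \in unitmx.
Proof.
move=> [_ [_ _ _ [s s1 frF]]] cy; have [P Pu Ps] := frF c y cy.
have : P *m metric F c y *m P^T \in unitmx.
  rewrite Ps unitmxE det_diag unitfE; apply/prodf_neq0 => i _.
  by case: (s1 i) => ->; rewrite ?oppr_eq0 oner_eq0.
by rewrite !unitmx_mul => /andP[/andP[]].
Qed.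

Lemma linform_surj (R : realType) (n : nat) (alpha : 'I_n -> R) t :
  (exists i, alpha i <> 0) -> exists x, linform alpha x = t.
Proof.
move=> [i /eqP ai]; exists (t / alpha i *: delta_mx 0 i).
by rewrite linearZ /= linform_delta -[LHS]/(t / alpha i * alpha i) divfK.
Qed.

Theorem theorem2p3 (R : realType) (n m : nat) (hn : (3 <= n)%N) (hm : (1 <= m)%N)
    (eps : 'I_n -> R) (heps : forall i, eps i = 1 \/ eps i = -1)
    (F : pre_semi_riemannian R m) (lambdaF : R)
    (hF : semi_riemannian F) (hFE : einstein F lambdaF)
    (alpha : 'I_n -> R) (halpha : exists i, alpha i <> 0)
    (hnorm : (exists i0, \sum_(i < n) eps i * alpha i ^+ 2 = eps i0) \/
             \sum_(i < n) eps i * alpha i ^+ 2 = 0)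
    (f phi h : R -> R)
    (f_smooth : smooth1 f) (phi_smooth : smooth1 phi) (h_smooth : smooth1 h)
    (f_pos : forall t, 0 < f t) (phi_neq0 : forall t, phi t <> 0)
    (h_neq0 : forall t, h t <> 0)
    (r : nat) (hr : (1 <= r)%N) (rho : R) :
  let xi := fun x : 'rV[R]_n => \sum_(i < n) alpha i * x 0 i in
  let Rn := conformal_change (M := pseudo_euclidean eps) (phi \o xi) in
  let M := warped_product (B := Rn) F (f \o xi) in
  let f' : R -> R := f^`() in let f'' : R -> R := f^`(2) in
  let phi' : R -> R := phi^`() in let phi'' : R -> R := phi^`(2) in
  let h' : R -> R := h^`() in let h'' : R -> R := h^`(2) in
  let system1 := forall t : R,
    (n%:R - 2) * f t * h t * phi'' t - r%:R * f t * phi t * h'' t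
      - m%:R * h t * phi t * f'' t - 2 * m%:R * h t * phi' t * f' t
      - 2 * r%:R * f t * phi' t * h' t = 0 in
  quasi_einstein (M := M) (fun p => h (xi p.1)) r rho <->
  ((exists i0, \sum_(i < n) eps i * alpha i ^+ 2 = eps i0) ->
     [/\ system1,
         forall t : R,
           \sum_(k < n) eps k * alpha k ^+ 2 *
             (f t * h t * phi t * phi'' t
                - (n%:R - 1) * f t * h t * phi' t ^+ 2
                + m%:R * h t * phi t * phi' t * f' t
                + r%:R * f t * phi t * phi' t * h' t)
           = rho * f t * h t &
         forall t : R,
           \sum_(k < n) eps k * alpha k ^+ 2 *
             (- (f t * h t * phi t ^+ 2 * f'' t)
                + (n%:R - 2) * f t * h t * phi t * phi' t * f' t
                - (m%:R - 1) * h t * phi t ^+ 2 * f' t ^+ 2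
                - r%:R * f t * phi t ^+ 2 * f' t * h' t)
           = h t * (rho * f t ^+ 2 - lambdaF)]) /\
  (\sum_(i < n) eps i * alpha i ^+ 2 = 0 ->
     [/\ system1, rho = 0 & lambdaF = 0]).
Proof.
move=> xi Rn M f' f'' phi' phi'' h' h'' system1.
have n1 : (1 < n)%N by exact: ltn_trans hn.
have f0 t : f t != 0 by rewrite gt_eqF.
have phi0 t : phi t != 0 by apply/eqP; exact: phi_neq0.
have h0 t : h t != 0 by apply/eqP; exact: h_neq0.
have eps2 i : eps i * eps i = 1.
  by case: (heps i) => ->; rewrite ?mulr1 // mulrNN mulr1.
have smooth_xi g : smooth1 g -> smooth_on (chart_cod (euclid_chart R n)) (g \o xi).
  move=> sg k; exact: sub_class_C (@subsetT _ _) (class_C_ridge alpha k sg).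
have smR : semi_riemannian M.
  apply: semi_riemannian_warped => // [b|c|]; first exact: f0.
    exact: smooth_xi.
  apply: semi_riemannian_conformal => [p|c|]; first exact: phi0.
    exact: smooth_xi.
  exact: semi_riemannian_pseudo_euclidean.
have [[_ _ [pF _] covF chF] _] := hF.1.
have [gC gsym _ _] := hF.2.
pose N := \sum_(i < n) eps i * alpha i ^+ 2.
(* The base has one global chart, so the charts of M are the pairs [(tt, d)]; the curvature
   computation is applied with the image of the chart [d] as the open set [A]. *)
have at_x d x : chart_cod (atlas F d) (rsubmx x) ->
  (let hc := (fun p : M => h (xi p.1)) \o chart_inv (atlas M (tt, d)) in
   forall i j, ricci (metric M (tt, d)) i j x
      - r%:R / hc x * hessian (metric M (tt, d)) hc i j x
      = rho * metric M (tt, d) x i j) <->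
  let t := linform alpha (lsubmx x) in
  [/\ qe_mixed n m f phi h r t = 0,
      N * qe_base n m f phi h r t = rho * f t * h t &
      N * qe_fibre n m f phi h r t = h t * (rho * f t ^+ 2 - lambdaF)].
  move=> dx; have [_ od _ _ _] := chF d.
  apply: (@quasi_einstein_at R n m eps alpha eps2 f phi f_smooth phi_smooth f0 phi0
    (metric F d) (chart_cod (atlas F d)) od) => //.
  - by move=> a b; exact: (gC d a b 1%N).
  - by move=> y dy; exact: metric_unitmx.
  - by move=> y dy; exact: gsym.
  - by move=> y dy; exact: hFE.
have qeP : quasi_einstein (M := M) (fun p => h (xi p.1)) r rho <->
  forall t, [/\ qe_mixed n m f phi h r t = 0,
      N * qe_base n m f phi h r t = rho * f t * h t &
      N * qe_fibre n m f phi h r t = h t * (rho * f t ^+ 2 - lambdaF)].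
  split=> [[_ qe] t|eqs]; last first.
    split=> // -[[] d] x; rewrite prod_chart_cod => -[_ dx].
    by apply/(at_x d x dx); exact: eqs.
  (* To reach a given t, a base point on the hyperplane xi = t is paired with some point of F in
     some chart. *)
  have [y yt] := linform_surj t halpha.
  have [d dp] := covF pF.
  pose x := row_mx y (chart_map (atlas F d) pF).
  have dx : chart_cod (atlas F d) (rsubmx x) by rewrite row_mxKr; exists pF.
  have cx : chart_cod (atlas M (tt, d)) x.
    by rewrite prod_chart_cod; split=> //; exists y => //=; rewrite row_mxKl.
  have <- : linform alpha (lsubmx x) = t by rewrite row_mxKl.
  exact: (at_x d x dx).1 (qe (tt, d) x cx).
rewrite qeP; split=> [eqs|[eqs_norm eqs_null] t].
  split=> [_|N0].
    split=> t; have [mixed base fibre] := eqs t; first exact: mixed.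
      (* The summation in the statement extends over the whole product; the factor without k is
         taken out to recover N. *)
      by rewrite -big_distrl; exact: base.
    by rewrite -big_distrl; exact: fibre.
  (* Any single value of t would do, as rho and [lambdaF] are constants. *)
  have [_ base fibre] := eqs 0.
  have rho0 : rho = 0.
    move/esym/eqP: base; rewrite /N N0 mul0r !mulf_eq0 (negPf (f0 0)) (negPf (h0 0)).
    by rewrite !orbF => /eqP.
  split=> [t||]; [by have [] := eqs t|exact: rho0|].
  move/esym/eqP: fibre; rewrite /N N0 mul0r rho0 mul0r sub0r mulf_eq0.
  by rewrite (negPf (h0 0)) oppr_eq0 => /eqP.
(* Each alternative for N activates one of the two assumed implications; in the null case both sides
   of the last two equations vanish. *)
case: hnorm => [/eqs_norm|N0].
  move=> [mixed base fibre]; split; first exact: mixed.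
    by have := base t; rewrite -big_distrl.
  by have := fibre t; rewrite -big_distrl.
have [mixed rho0 lambda0] := eqs_null N0; split; first exact: mixed.
  by rewrite /N N0 rho0 !mul0r.
by rewrite /N N0 rho0 lambda0 !mul0r subrr mulr0.
Qed.
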